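(* Let $A$ be a positive self-adjoint operator on $L^2(X,\mu)$, where $(X,\mu)$ is a measure space, let $V=L^2(X)\cap(\ker A)^\perp$ and let $\Pi_V$ be the orthogonal projection onto $V$. Suppose that $L(t)=\|e^{-tA}\Pi_V\|_{1,\infty}$ is finite for all $t>0$ and that $$M(t)=\int_t^{+\infty}L(u)\,du<+\infty\quad\text{for all } t>0.$$ Then any non-zero $f\in V$ of finite energy $\mathcal{E}(f)=\langle Af,f\rangle_2$ satisfies $$\int_X N\Bigl(\frac{|f(x)|^2}{4\,\mathcal{E}(f)}\Bigr)\,d\mu(x)\le \ln 2,$$ where $N(y)=y/M^{-1}(y)$.
   Context: ''Positive'' means $\langle Af,f\rangle\ge 0$; $A$ may be unbounded and may have a kernel. The energy is $\mathcal{E}(f)=\|A^{1/2}f\|_2^2$, finite exactly when $f$ is in the domain of $A^{1/2}$. For a bounded operator $P$ on $L^2(X)$, $\|P\|_{1,\infty}=\sup\{\|Pf\|_\infty : f\in L^1\cap L^2,\ \|f\|_1\le 1\}\in[0,+\infty]$ is its norm as an operator from $L^1$ to $L^\infty$. $M$ is non-increasing and $M^{-1}$ denotes its right continuous inverse $M^{-1}(y)=\inf\{t>0 : M(t)\le y\}\in[0,+\infty]$ (with $\inf\emptyset=+\infty$); thus $N(0)=0$, and $N(y)=+\infty$ if $y>0$ and $M^{-1}(y)=0$. *)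

(* Defs.v *)
From HB Require Import structures.
From mathcomp Require Import all_boot all_order all_algebra.
From mathcomp Require Import complex.
From mathcomp Require Import all_classical all_reals all_analysis.

Set Implicit Arguments.
Unset Strict Implicit.
Unset Printing Implicit Defensive.

Import Order.TTheory GRing.Theory Num.Theory.
Import numFieldNormedType.Exports.

Local Open Scope classical_set_scope.
Local Open Scope ring_scope.

(* L^2(X, mu) is the complex Hilbert space.  Its elements are handled through
   representatives f : X -> R[i], equality being equality mu-a.e.  No finiteness
   assumption is put on mu. *)

Section L2.
Context {R : realType} {d : measure_display} {X : measurableType d}.
Variable mu : {measure set X -> \bar R}.
Implicit Types f g : X -> R[i].

Definition cmeasurable f : Prop :=
  measurable_fun setT (fun x => complex.Re (f x)) /\
  measurable_fun setT (fun x => complex.Im (f x)).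

Definition cLnorm (p : \bar R) f : \bar R :=
  Lnorm mu p (fun x => (Normc.normc (f x))%:E).

Definition inLp (p : \bar R) f : Prop :=
  cmeasurable f /\ (cLnorm p f < +oo)%E.

Definition inL2 f : Prop := inLp 2%:E f.

Definition norm2 f : R := fine (cLnorm 2%:E f).

Definition cintegral f : R[i] :=
  Complex (\int[mu]_x complex.Re (f x)) (\int[mu]_x complex.Im (f x)).

(* linear in the first variable, antilinear in the second *)
Definition inner f g : R[i] := cintegral (fun x => f x * conjc (g x)).

End L2.

(* A possibly unbounded operator is given by its graph: A f g means that f is in
   the domain of A and g represents A f. *)
Definition graph (R : realType) (d : measure_display) (X : measurableType d) :=
  (X -> R[i]) -> (X -> R[i]) -> Prop.

Section operators.
Context {R : realType} {d : measure_display} {X : measurableType d}.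
Variable mu : {measure set X -> \bar R}.
Implicit Types (f g h u v p : X -> R[i]) (A P Q : graph R X).

Record linear_operator A : Prop := LinearOperator {
  operator_inL2 : forall f g, A f g -> inL2 mu f /\ inL2 mu g ;
  operator_linear : forall (a : R[i]) f g f' g', A f g -> A f' g' ->
    A (fun x => a * f x + f' x) (fun x => a * g x + g' x) ;
  operator_ae : forall f g f' g', A f g -> inL2 mu f' -> inL2 mu g' ->
    f = f' %[ae mu] -> g = g' %[ae mu] -> A f' g' ;
  operator_functional : forall f g f' g', A f g -> A f' g' ->
    f = f' %[ae mu] -> g = g' %[ae mu] }.

Definition densely_defined A : Prop :=
  forall f, inL2 mu f -> forall e : R, 0 < e ->
    exists u v, A u v /\ norm2 mu (fun x => f x - u x) < e.

Definition adjoint A : graph R X := fun f g =>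
  [/\ inL2 mu f, inL2 mu g & forall u v, A u v -> inner mu v f = inner mu u g].

Definition selfadjoint A : Prop :=
  [/\ linear_operator A, densely_defined A &
      forall f g, A f g <-> adjoint A f g].

Definition positive_operator A : Prop :=
  forall f g, A f g -> 0 <= inner mu g f.

Definition kerA A : set (X -> R[i]) := [set h | A h (fun=> 0)].

Definition orthogonal_of (K : set (X -> R[i])) : set (X -> R[i]) :=
  [set f | inL2 mu f /\ forall h, K h -> inner mu f h = 0].

Definition orthogonal_projection (V : set (X -> R[i])) : graph R X :=
  fun f p => [/\ inL2 mu f, V p &
    forall v, V v -> inner mu (fun x => f x - p x) v = 0].

Definition graph_comp P Q : graph R X := fun f h => exists2 g, Q f g & P g h.

Definition norm1oo P : \bar R :=
  ereal_sup [set z | exists f g, [/\ inLp mu 1%:E f, inL2 mu f,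
    (cLnorm mu 1%:E f <= 1)%E, P f g & z = cLnorm mu +oo%E g]].

End operators.

Section functional_calculus.
Context {R : realType} {d : measure_display} {X : measurableType d}.
Variable mu : {measure set X -> \bar R}.
Implicit Types (f g h : X -> R[i]) (A : graph R X).
Implicit Types (E : set R -> (X -> R[i]) -> (X -> R[i])) (phi : R -> R).

(* the scalar spectral measure B |-> <E(B) f, f> *)
Definition spectral_weight E f : set R -> \bar R :=
  fun B => (complex.Re (inner mu (E B f) f))%:E.

(* E is a projection-valued Borel measure on the real line: each E(B) is
   symmetric and, by multiplicativity, idempotent; linearity (a.e.) of E(B)
   follows from symmetry. *)
Record projection_valued_measure E : Prop := ProjectionValuedMeasure {
  pvm_inL2 : forall B f, measurable B -> inL2 mu f -> inL2 mu (E B f) ;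
  pvm_sym : forall B f g, measurable B -> inL2 mu f -> inL2 mu g ->
    inner mu (E B f) g = inner mu f (E B g) ;
  pvm_setI : forall B C f, measurable B -> measurable C -> inL2 mu f ->
    E (B `&` C) f = E B (E C f) %[ae mu] ;
  pvm_setT : forall f, inL2 mu f -> E setT f = f %[ae mu] ;
  pvm_sigma_additive : forall f, inL2 mu f ->
    semi_sigma_additive (spectral_weight E f) }.

Definition spectral_dom E phi : set (X -> R[i]) := [set f | inL2 mu f /\
  (\int[spectral_weight E f]_l ((phi l) ^+ 2)%:E < +oo)%E].

Definition spectral_quad E phi f : R :=
  fine (\int[spectral_weight E f]_l (phi l)%:E)%E.

(* \int phi d<E f, h>, where the complex measure <E(.) f, h> is obtained from
   the measures <E(.) u, u> by polarization *)
Definition spectral_form E phi f h : R[i] :=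
  Complex
    ((spectral_quad E phi (fun x => f x + h x)
      - spectral_quad E phi (fun x => f x - h x)) / 4)
    ((spectral_quad E phi (fun x => f x + Complex 0 1 * h x)
      - spectral_quad E phi (fun x => f x - Complex 0 1 * h x)) / 4).

(* the operator \int phi dE.  The test functions h range over the dense
   subspace spectral_dom E phi, where every integral in the polarization
   formula is finite. *)
Definition spectral_integral E phi : graph R X := fun f g =>
  [/\ spectral_dom E phi f, inL2 mu g &
      forall h, spectral_dom E phi h -> inner mu g h = spectral_form E phi f h].

Definition spectral_resolution A E : Prop :=
  projection_valued_measure E /\
  forall f g, A f g <-> spectral_integral E id f g.

(* phi(A).  By the spectral theorem a self-adjoint A has exactly one spectral
   resolution, up to mu-a.e. equality of the E(B) f. *)
Definition fcalc A phi : graph R X := fun f g =>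
  exists2 E, spectral_resolution A E & spectral_integral E phi f g.

Definition heat A (t : R) : graph R X := fcalc A (fun l => expR (- t * l)).

(* Num.sqrt is 0 on negative reals, which do not meet the spectrum of a
   positive operator. *)
Definition sqrt_operator A : graph R X := fcalc A Num.sqrt.

End functional_calculus.

Section profile.
Context {R : realType} {d : measure_display} {X : measurableType d}.
Variables (mu : {measure set X -> \bar R}) (A : graph R X).

Definition V_space : set (X -> R[i]) := orthogonal_of mu (kerA A).

Definition L_fun (t : R) : \bar R :=
  norm1oo mu (graph_comp (heat mu A t) (orthogonal_projection mu V_space)).

Definition M_fun (t : R) : \bar R :=
  (\int[lebesgue_measure]_(u in `]t, +oo[) L_fun u)%E.

Definition M_inv (y : R) : \bar R :=
  ereal_inf [set t%:E | t in [set t : R | 0 < t /\ (M_fun t <= y%:E)%E]].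

(* In \bar R, 0^-1 = +oo, +oo^-1 = 0 and 0 * +oo = 0, so that N_fun 0 = 0 and
   N_fun y = +oo when y > 0 and M_inv y = 0. *)
Definition N_fun (y : R) : \bar R := (y%:E / M_inv y)%E.

End profile.

(* Main.v *)
Require Import Defs.
From HB Require Import structures.
From mathcomp Require Import all_boot all_order all_algebra.
From mathcomp Require Import complex ring lra.
From mathcomp Require Import all_classical all_reals all_analysis.
From mathcomp Require Import measurable_realfun ess_sup_inf.

Set Implicit Arguments.
Unset Strict Implicit.
Unset Printing Implicit Defensive.

Import Order.TTheory GRing.Theory Num.Theory.
Import numFieldNormedType.Exports.

Local Open Scope classical_set_scope.
Local Open Scope ring_scope.

(* Write T_t = e^{-tA} and nu_u for the spectral measure of u.  For f in V,
   Cauchy-Schwarz in the functional calculus gives, whenever |u|_1 <= 1,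
     <T_t f, u>^2 <= E(f) \int_{l > 0} e^{-2tl} / l dnu_u(l)
                   = E(f) \int_{2t}^oo <T_s Pi_V u, u> ds <= E(f) M(2t),
   hence |T_t f|^2 <= E(f) M(2t) a.e. and |f - T_t f|^2 >= |f|^2 / 4 at the points
   where M(2t) <= |f|^2 / (4 E(f)).  Integrating dt/t^2 over such t bounds
   |f|^2 / M^{-1}(|f|^2 / (4 E(f))), while
     \int_0^oo (1 - e^{-tl})^2 dt/t^2 = 2 l ln 2.
   The t-integral is replaced by sums over geometric grids of ratio 2^(1/p),
   p -> oo, and Fatou's lemma: no joint measurability in (x, t), no sigma-finiteness
   of mu and no measurability of N is then needed, and the sums telescope. *)

Import HBNNSimple.

(** The norm |P|_{1,oo} is a supremum over pairs (u, P u), so <T_s Pi_V u, u> <= L(s) can be claimed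
    only once T_s Pi_V u is known to exist in L^2. As phi(A) is defined weakly, through its inner
    products, this vector has to be built. That is the purpose of the completeness argument, of the
    binary expansion of phi, and of the identification of Pi_V with E(]0, +oo[), where positivity
    and the kernel enter. The constants: put y = |f|^2 / (4 E(f)). The 4 makes M(2t) <= y mean |T_t
    f| <= |f| / 2, so that |f - T_t f|^2 is at least |f|^2 / 4 = E(f) y for 2t > M^{-1}(y). These t
    have dt/t^2 mass 2 / M^{-1}(y), so the pointwise lower bound is 2 E(f) N(y), while the spectral
    side is at most 2 ln 2 E(f); the factor 2 E(f) cancels. With a continuous parameter, T_t f would
    be defined only off a null set depending on t. A grid has countably many t, so a single null set
    serves for all of them. *)

Local Notation re := (@complex.Re _).
Local Notation im := (@complex.Im _).

(** * The real Hilbert space underlying L^2 *)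

Section complex_facts.
Context {R : rcfType}.
Implicit Types x y z : R[i].

Lemma re_mul x y : re (x * y) = re x * re y - im x * im y.
Proof. by case: x => ? ?; case: y. Qed.

Lemma im_mul x y : im (x * y) = re x * im y + im x * re y.
Proof. by case: x => ? ?; case: y. Qed.

Lemma re_add x y : re (x + y) = re x + re y.
Proof. by case: x => ? ?; case: y. Qed.

Lemma im_add x y : im (x + y) = im x + im y.
Proof. by case: x => ? ?; case: y. Qed.

Lemma re_opp x : re (- x) = - re x.
Proof. by case: x. Qed.

Lemma im_opp x : im (- x) = - im x.
Proof. by case: x. Qed.

Lemma re_conj x : re (conjc x) = re x.
Proof. by case: x. Qed.

Lemma im_conj x : im (conjc x) = - im x.
Proof. by case: x. Qed.

Definition reimE := (re_mul, im_mul, re_add, im_add, re_opp, im_opp, re_conj, im_conj).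

Definition sqc z : R := re z ^+ 2 + im z ^+ 2.

Lemma sqc_ge0 z : 0 <= sqc z.
Proof. by rewrite addr_ge0// sqr_ge0. Qed.

Lemma normc_sqc z : Normc.normc z ^+ 2 = sqc z.
Proof. by rewrite /sqc; case: z => a b /=; rewrite sqr_sqrtr// addr_ge0// sqr_ge0. Qed.

Lemma normc_ge0 z : 0 <= Normc.normc z.
Proof. by case: z => a b /=; exact: sqrtr_ge0. Qed.

Lemma complexP x y : re x = re y -> im x = im y -> x = y.
Proof. by case: x => ? ?; case: y => ? ? /= -> ->. Qed.

End complex_facts.

Section L2.
Context {R : realType} {d : measure_display} {X : measurableType d}.
Variable mu : {measure set X -> \bar R}.
Implicit Types (f g h u v : X -> R[i]).

Definition real_inner f g : R := re (inner mu f g).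

Local Notation ip := real_inner.

Lemma inL2P f : inL2 mu f <-> cmeasurable f /\
  mu.-integrable setT (EFin \o (fun x => sqc (f x))).
Proof.
have E : (cLnorm mu 2%:E f `^ 2 =
    \int[mu]_x `| (EFin \o (fun x => sqc (f x))) x|)%E.
  rewrite /cLnorm poweR_Lnorm//; apply: eq_integral => x _ /=.
  rewrite ger0_norm ?normc_ge0// powR_mulrn ?normc_ge0// normc_sqc.
  by rewrite ger0_norm// sqc_ge0.
split=> [[mf lf]|[mf lf]]; split => //.
- apply/integrableP; split.
    apply/measurable_EFinP; case: mf => mr mi.
    by apply: measurable_funD; exact: measurable_funX.
  by rewrite -E; exact: poweR_lty.
- by case/integrableP: lf => _; rewrite -E; apply: lty_poweRy.
Qed.

Lemma inL2_measurable_re f : inL2 mu f -> measurable_fun setT (fun x => re (f x)).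
Proof. by case=> -[]. Qed.

Lemma inL2_measurable_im f : inL2 mu f -> measurable_fun setT (fun x => im (f x)).
Proof. by case=> -[]. Qed.

Lemma inL2_integrable_mul f g (p q : R[i] -> R) :
  (p = re \/ p = im) -> (q = re \/ q = im) -> inL2 mu f -> inL2 mu g ->
  mu.-integrable setT (EFin \o (fun x => p (f x) * q (g x))).
Proof.
move=> Hp Hq /inL2P[[fr fi] If] /inL2P[[gr gi] Ig].
have mp : measurable_fun setT (fun x => p (f x)) by case: Hp => ->.
have mq : measurable_fun setT (fun x => q (g x)) by case: Hq => ->.
have := integrableD measurableT If Ig.
apply: le_integrable => //; first exact/measurable_EFinP/measurable_funM.
move=> x _ /=; rewrite lee_fin /sqc.
set r1 := re (f x); set i1 := im (f x); set r2 := re (g x); set i2 := im (g x).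
have P1 : p (f x) ^+ 2 <= r1 ^+ 2 + i1 ^+ 2.
  by case: Hp => ->; rewrite ?lerDl ?lerDr sqr_ge0.
have P2 : q (g x) ^+ 2 <= r2 ^+ 2 + i2 ^+ 2.
  by case: Hq => ->; rewrite ?lerDl ?lerDr sqr_ge0.
rewrite [leRHS]ger0_norm; last by rewrite !addr_ge0// sqr_ge0.
rewrite ler_norml; apply/andP; split; nra.
Qed.

Lemma inL2_lin (a : R[i]) f g : inL2 mu f -> inL2 mu g ->
  inL2 mu (fun x => a * f x + g x).
Proof.
move=> /[dup] Hf /inL2P[[fr fi] If] /[dup] Hg /inL2P[[gr gi] Ig].
have mr : measurable_fun setT (fun x => re (a * f x + g x)).
  apply: (eq_measurable_fun (fun x => re a * re (f x) - im a * im (f x) + re (g x))).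
    by move=> x _; rewrite !reimE.
  by apply: measurable_funD => //; apply: measurable_funB; exact: measurable_funM.
have mi : measurable_fun setT (fun x => im (a * f x + g x)).
  apply: (eq_measurable_fun (fun x => re a * im (f x) + im a * re (f x) + im (g x))).
    by move=> x _; rewrite !reimE.
  by apply: measurable_funD => //; apply: measurable_funD; exact: measurable_funM.
apply/inL2P; split => //.
have /= := integrableD measurableT
  (integrableZl measurableT (2 * (re a ^+ 2 + im a ^+ 2)) If)
  (integrableZl measurableT 2 Ig).
apply: le_integrable => //.
  by apply/measurable_EFinP; apply: measurable_funD; exact: measurable_funX.
move=> x _ /=; rewrite lee_fin /sqc !reimE.
set r1 := re (f x); set i1 := im (f x); set r2 := re (g x); set i2 := im (g x).
have S p q : 0 <= p ^+ 2 + q ^+ 2 :> R by rewrite addr_ge0// sqr_ge0.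
rewrite !ger0_norm ?S//; last by rewrite addr_ge0// !mulr_ge0// S.
(* Parallelogram law: 2|az|^2 + 2|w|^2 exceeds |az + w|^2 by |az - w|^2. *)
rewrite -subr_ge0.
have -> : 2 * (re a ^+ 2 + im a ^+ 2) * (r1 ^+ 2 + i1 ^+ 2) + 2 * (r2 ^+ 2 + i2 ^+ 2) -
  ((re a * r1 - im a * i1 + r2) ^+ 2 + (re a * i1 + im a * r1 + i2) ^+ 2) =
  (re a * r1 - im a * i1 - r2) ^+ 2 + (re a * i1 + im a * r1 - i2) ^+ 2 by ring.
exact: S.
Qed.

Lemma inL2_0 : inL2 mu (fun=> 0).
Proof.
apply/inL2P; split; first by split; exact: measurable_cst.
apply: (eq_integrable measurableT (cst 0%E)); last exact: integrable0.
by move=> x _ /=; rewrite /sqc /= expr0n /= addr0.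
Qed.

Lemma inL2D f g : inL2 mu f -> inL2 mu g -> inL2 mu (fun x => f x + g x).
Proof.
move=> Hf Hg; have := inL2_lin 1 Hf Hg.
by under eq_fun do rewrite mul1r.
Qed.

Lemma inL2Z (a : R[i]) f : inL2 mu f -> inL2 mu (fun x => a * f x).
Proof.
move=> Hf; have := inL2_lin a Hf inL2_0.
by under eq_fun do rewrite addr0.
Qed.

Lemma inL2B f g : inL2 mu f -> inL2 mu g -> inL2 mu (fun x => f x - g x).
Proof.
move=> Hf Hg; have := inL2_lin (-1) Hg Hf.
by under eq_fun do rewrite mulN1r addrC.
Qed.

Lemma ipE f g : ip f g = \int[mu]_x (re (f x) * re (g x) + im (f x) * im (g x)).
Proof.
rewrite /real_inner /inner /cintegral /=; apply: eq_Rintegral => x _.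
by rewrite !reimE mulrN opprK.
Qed.

(** By antilinearity in the second variable, Im <f, g> = Re <f, i g>. A complex identity thus
    reduces to the real one tested on g and on i g. *)
Lemma innerE f g : inner mu f g = Complex (ip f g) (ip f (fun x => Complex 0 1 * g x)).
Proof.
rewrite ipE -ipE; apply: complexP => //=; rewrite ipE; apply: eq_Rintegral => x _.
by rewrite !reimE /=; ring.
Qed.

Lemma ip_integrable f g : inL2 mu f -> inL2 mu g ->
  mu.-integrable setT (EFin \o (fun x => re (f x) * re (g x) + im (f x) * im (g x))).
Proof.
move=> Hf Hg; have I p (Hp : p = re \/ p = im) := inL2_integrable_mul Hp Hp Hf Hg.
exact: (integrableD measurableT (I _ (or_introl erefl)) (I _ (or_intror erefl))).
Qed.

Lemma ipC f g : ip f g = ip g f.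
Proof. by rewrite !ipE; apply: eq_Rintegral => x _; ring. Qed.

Lemma ip_linl (c : R) f g h : inL2 mu f -> inL2 mu g -> inL2 mu h ->
  ip (fun x => Complex c 0 * f x + g x) h = c * ip f h + ip g h.
Proof.
move=> Hf Hg Hh; rewrite !ipE -RintegralZl//; last exact: ip_integrable.
rewrite -RintegralD//; last 2 first.
- by have := integrableZl measurableT c (ip_integrable Hf Hh); apply: eq_integrable.
- exact: ip_integrable.
by apply: eq_Rintegral => x _; rewrite !reimE /=; ring.
Qed.

Lemma ipDl f g h : inL2 mu f -> inL2 mu g -> inL2 mu h ->
  ip (fun x => f x + g x) h = ip f h + ip g h.
Proof.
move=> Hf Hg Hh; rewrite -[X in X + _]mul1r -ip_linl//.
by congr (ip _ _); apply/funext => x; rewrite mul1r.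
Qed.

Lemma ipZl (c : R) f h : inL2 mu f -> inL2 mu h ->
  ip (fun x => Complex c 0 * f x) h = c * ip f h.
Proof.
move=> Hf Hh; rewrite !ipE -RintegralZl//; last exact: ip_integrable.
by apply: eq_Rintegral => x _; rewrite !reimE /=; ring.
Qed.

Lemma ipBl f g h : inL2 mu f -> inL2 mu g -> inL2 mu h ->
  ip (fun x => f x - g x) h = ip f h - ip g h.
Proof.
move=> Hf Hg Hh; rewrite -[X in _ - X]mul1r -mulNr [RHS]addrC -ip_linl//.
congr (ip _ _); apply/funext => x; rewrite [LHS]addrC; congr (_ + _).
by apply: complexP; rewrite !reimE /=; ring.
Qed.

Lemma ipDr f g h : inL2 mu f -> inL2 mu g -> inL2 mu h ->
  ip h (fun x => f x + g x) = ip h f + ip h g.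
Proof. by move=> *; rewrite ipC ipDl// ![ip _ h]ipC. Qed.

Lemma ipBr f g h : inL2 mu f -> inL2 mu g -> inL2 mu h ->
  ip h (fun x => f x - g x) = ip h f - ip h g.
Proof. by move=> *; rewrite ipC ipBl// ![ip _ h]ipC. Qed.

Lemma ipZr (c : R) f h : inL2 mu f -> inL2 mu h ->
  ip h (fun x => Complex c 0 * f x) = c * ip h f.
Proof. by move=> *; rewrite ipC ipZl// ![ip _ h]ipC. Qed.

Lemma ip_i f g : ip (fun x => Complex 0 1 * f x) (fun x => Complex 0 1 * g x) = ip f g.
Proof. by rewrite !ipE; apply: eq_Rintegral => x _; rewrite !reimE /=; ring. Qed.

Lemma ip_ge0 f : 0 <= ip f f.
Proof.
rewrite ipE; apply: Rintegral_ge0 => x _.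
by rewrite -!expr2 addr_ge0// sqr_ge0.
Qed.

Lemma ip0l g : ip (fun=> 0) g = 0.
Proof.
rewrite ipE /Rintegral; under eq_integral do rewrite /= !mul0r addr0.
by rewrite integral0.
Qed.

Lemma norm2_ip f : inL2 mu f -> norm2 mu f ^+ 2 = ip f f.
Proof.
move=> Hf; rewrite /norm2 -powR_mulrn ?fine_ge0 ?Lnorm_ge0// -fine_poweR.
rewrite /cLnorm poweR_Lnorm// ipE /Rintegral; congr fine.
apply: eq_integral => x _ /=.
by rewrite ger0_norm ?normc_ge0// powR_mulrn ?normc_ge0// normc_sqc /sqc !expr2.
Qed.

Lemma ip_cauchy_schwarz f g : inL2 mu f -> inL2 mu g ->
  ip f g ^+ 2 <= ip f f * ip g g.
Proof.
move=> Hf Hg.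
have Q c : 0 <= c ^+ 2 * ip f f + 2 * c * ip f g + ip g g.
  have := ip_ge0 (fun x => Complex c 0 * f x + g x).
  have Hc := inL2_lin (Complex c 0) Hf Hg.
  rewrite ip_linl// ![ip _ (fun x => _ + _)]ipC !ip_linl// [ip g f]ipC.
  by congr (_ <= _); ring.
have := ip_ge0 f; rewrite le_eqVlt => /predU1P[f0|f0].
  rewrite -f0 mul0r; have [->|fg0] := eqVneq (ip f g) 0; first by rewrite expr0n.
  (* With [ip f f = 0] the polynomial is affine in c; this c gives it the value -1. *)
  have := Q (- (ip g g + 1) / (2 * ip f g)); rewrite -f0 mulr0 add0r.
  have -> : 2 * (- (ip g g + 1) / (2 * ip f g)) * ip f g = - (ip g g + 1) by field.
  by rewrite opprD addrAC addNr add0r oppr_ge0 leNgt ltr01.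
(* The minimizer of the quadratic polynomial. *)
have := Q (- ip f g / ip f f).
have -> : (- ip f g / ip f f) ^+ 2 * ip f f + 2 * (- ip f g / ip f f) * ip f g + ip g g
  = (ip f f * ip g g - ip f g ^+ 2) / ip f f by field; rewrite gt_eqF.
by rewrite pmulr_lge0 ?invr_gt0// subr_ge0.
Qed.

Lemma ip_ae f f' g g' : inL2 mu f -> inL2 mu f' -> inL2 mu g -> inL2 mu g' ->
  f = f' %[ae mu] -> g = g' %[ae mu] -> ip f g = ip f' g'.
Proof.
move=> Hf Hf' Hg Hg' ff' gg'; rewrite !ipE /Rintegral; congr fine.
apply: ae_eq_integral => //.
- by case/integrableP: (ip_integrable Hf Hg).
- by case/integrableP: (ip_integrable Hf' Hg').
by move: ff' gg'; apply: filterS2 => x + + xT => -> // -> //.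
Qed.

Lemma ip_eq0_ae f : inL2 mu f -> ip f f = 0 -> f = (fun=> 0) %[ae mu].
Proof.
move=> Hf; rewrite ipE /Rintegral => f0.
have If := ip_integrable Hf Hf.
set F := EFin \o _ in If.
have : (\int[mu]_x `|F x| = 0)%E.
  rewrite -[RHS]/(0%:E) -f0 fineK; last exact: integrable_fin_num.
  apply: eq_integral => x _ /=; rewrite ger0_norm//.
  by rewrite -!expr2 addr_ge0// sqr_ge0.
have mf : measurable_fun setT F by case/integrableP: If.
move/(ae_eq_integral_abs mu measurableT mf); apply: filterS => x /(_ I) /= [] /eqP.
rewrite -!expr2 paddr_eq0 ?sqr_ge0// !sqrf_eq0 => /andP[/eqP rf /eqP fi] _.
exact: complexP.
Qed.

End L2.

(** * Completeness *)

Section dyadic_series.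
Context {R : realType}.

Definition dyadic (k : nat) : R := (2 ^- k.+1).

Lemma dyadic_gt0 k : 0 < dyadic k.
Proof. by rewrite /dyadic invr_gt0 exprn_gt0. Qed.

Lemma sum_dyadic n : \sum_(k < n) dyadic k = 1 - 2 ^- n.
Proof.
elim: n => [|n IH]; first by rewrite big_ord0 expr0 invr1 subrr.
rewrite big_ord_recr/= IH /dyadic exprS invfM; field.
by rewrite expf_neq0.
Qed.

Lemma sum_dyadic_le1 n : \sum_(k < n) dyadic k <= 1.
Proof. by rewrite sum_dyadic lerBlDr lerDl invr_ge0 exprn_ge0. Qed.

(** Since |a| <= 1 + a^2 and the weights sum to at most 1, a bound on the weighted squares gives
    absolute convergence. *)
Lemma dy_series_cvg (a : nat -> R) (M : R) :
  (forall n, \sum_(k < n) dyadic k * a k ^+ 2 <= M) -> cvgn (series (fun k => dyadic k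
    * a k)).
Proof.
move=> aM; apply: normed_cvg; apply: nondecreasing_is_cvgn.
  by apply: nondecreasing_series => k _ _; exact: normr_ge0.
exists (1 + M) => _ [n _ <-]; rewrite /= /series /= big_mkord.
apply: le_trans (lerD (sum_dyadic_le1 n) (aM n)); rewrite -big_split /=.
apply: ler_sum => k _; rewrite normrM gtr0_norm ?dyadic_gt0// -{2}[dyadic k]mulr1 -mulrDr.
rewrite ler_pM2l ?dyadic_gt0// ler_norml.
have := sqr_ge0 (a k - 1); have := sqr_ge0 (a k + 1) => *; apply/andP; split; nra.
Qed.

End dyadic_series.

Section completeness.
Context {R : realType} {d : measure_display} {X : measurableType d}.
Variable mu : {measure set X -> \bar R}.
Local Notation ip := (real_inner mu).

(** Completeness in the form needed later: a bounded sequence has a weak dyadic sum. The function H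
    = sum of 2^-(k+1) |g_k|^2 is integrable, so it is finite a.e.; where it is finite the series
    converges pointwise, and H + |u|^2 dominates its pairing with u. *)
Lemma L2_dyadic_series (g : nat -> X -> R[i]) (C : R) :
  (forall k, inL2 mu (g k)) -> (forall k, ip (g k) (g k) <= C) ->
  exists T, inL2 mu T /\ forall u, inL2 mu u ->
    \sum_(k < n) dyadic k * ip (g k) u @[n --> \oo] --> ip T u.
Proof.
move=> Hg HC.
pose h k x : \bar R := (dyadic k * sqc (g k x))%:E.
have h0 k x : (0 <= h k x)%E by rewrite lee_fin mulr_ge0 ?sqc_ge0// ltW// dyadic_gt0.
have mh k : measurable_fun setT (h k).
  have /inL2P[_] := Hg k => /integrableP[/measurable_EFinP m _].
  by apply/measurable_EFinP; exact: measurable_funM.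
pose H x := (\sum_(k <oo) h k x)%E.
have mH : measurable_fun setT H by apply: ge0_emeasurable_sum.
have H0 x : (0 <= H x)%E by apply: nneseries_ge0.
have inth k : (\int[mu]_x h k x = (dyadic k * ip (g k) (g k))%:E)%E.
  have Ik := ip_integrable (Hg k) (Hg k).
  have E : (\int[mu]_x h k x = (dyadic k)%:E * \int[mu]_x (re (g k x) * re (g k x) + im
    (g k x) * im (g k x))%:E)%E.
    rewrite -integralZl//; apply: eq_integral => x _.
  rewrite E ipE /Rintegral EFinM fineK//; exact: integrable_fin_num.
have IH : mu.-integrable setT H.
  apply/integrableP; split => //.
  apply: (@le_lt_trans _ _ C%:E); last exact: ltry.
  under eq_integral do rewrite gee0_abs//.
  rewrite integral_nneseries//; apply: lime_le.
    by apply: is_cvg_nneseries => k _ _; exact: integral_ge0.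
  apply: nearW => n; under eq_bigr do rewrite inth.
  rewrite sumEFin lee_fin big_mkord.
  have C0 : 0 <= C by apply: le_trans (HC 0%N); exact: ip_ge0.
  apply: (@le_trans _ _ (\sum_(k < n) dyadic k * C)).
    by apply: ler_sum => k _; rewrite ler_pM2l// dyadic_gt0.
  by rewrite -mulr_suml ler_piMl// sum_dyadic_le1.
pose G := [set x | H x < +oo]%E.
have mG : measurable G.
  by rewrite -[G]setTI; exact: emeasurable_fun_infty_o.
have aeG : {ae mu, forall x, G x}.
  have := integrable_ae measurableT IH; apply: filterS => x /(_ I).
  by rewrite /G /=; by rewrite ge0_fin_numE.
pose Hr x := fine (H x).
have sumH x n : G x -> \sum_(k < n) dyadic k * sqc (g k x) <= Hr x.
  move=> Gx; rewrite -lee_fin fineK ?ge0_fin_numE// -sumEFin -(big_mkord xpredT (h ^~ x)).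
  exact: nneseries_lim_ge.
have cvg_p (p : R[i] -> R) : (forall z, p z ^+ 2 <= sqc z) -> forall x, G x ->
    cvgn (series (fun k => dyadic k * p (g k x))).
  move=> pz x Gx; apply: (@dy_series_cvg _ _ (Hr x)) => n.
  apply: le_trans (sumH x n Gx); apply: ler_sum => k _.
  by rewrite ler_pM2l ?dyadic_gt0.
have re2 (z : R[i]) : re z ^+ 2 <= sqc z by rewrite lerDl sqr_ge0.
have im2 (z : R[i]) : im z ^+ 2 <= sqc z by rewrite lerDr sqr_ge0.
(* The value 0 off [G] keeps the pointwise limit measurable on the whole space. *)
pose L (p : R[i] -> R) x := if x \in G then limn (series (fun k => dyadic k * p (g k
  x))) else 0.
have mL (p : R[i] -> R) : (forall z, p z ^+ 2 <= sqc z) ->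
    (forall k, measurable_fun setT (fun x => p (g k x))) -> measurable_fun setT (L p).
  move=> pz mp.
  apply: (@measurable_fun_cvg _ _ _ _ (fun n x => \1_G x * series (fun k => dyadic k *
    p (g k x)) n)).
    move=> n; apply: measurable_funM => //.
    rewrite /series /=; apply: measurable_sum => k.
    exact: measurable_funM.
  move=> x _; rewrite /L indicE; case: ifPn => xG.
    under eq_fun do rewrite mul1r.
    by apply: cvg_p => //; exact/set_mem.
  by under eq_fun do rewrite mul0r; exact: cvg_cst.
pose T x := Complex (L re x) (L im x).
pose F (u : X -> R[i]) n x := \sum_(k < n) dyadic k * (re (g k x) * re (u x) + im (g k
  x) * im (u x)).
have FT u x : G x -> F u n x @[n --> \oo] --> re (T x) * re (u x) + im (T x) * im (u x).
  move=> Gx; rewrite /T /= /L mem_set//.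
  have -> : (F u)^~ x = (fun n => series (fun k => dyadic k * re (g k x)) n * re (u x)
      + series (fun k => dyadic k * im (g k x)) n * im (u x)).
    apply/funext => n; rewrite /F /series /= !big_mkord !mulr_suml -big_split /=.
    by apply: eq_bigr => k _; ring.
  exact: cvgD (cvgM (cvg_p _ re2 _ Gx) (cvg_cst _)) (cvgM (cvg_p _ im2 _ Gx) (cvg_cst _)).
(* From |ab| <= (a^2 + b^2) / 2 in each term, the weights having total at most 1. *)
have Fle u n x : G x -> `|F u n x| <= (Hr x + sqc (u x)) / 2.
  move=> Gx; rewrite /F; apply: le_trans (ler_norm_sum _ _ _) _.
  apply: (@le_trans _ _ (\sum_(k < n) dyadic k * (sqc (g k x) + sqc (u x)) / 2)).
    apply: ler_sum => k _; rewrite normrM gtr0_norm ?dyadic_gt0// -mulrA.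
    rewrite ler_pM2l ?dyadic_gt0//.
    set a := re (g k x); set b := im (g k x); set a' := re (u x); set b' := im (u x).
    have := sqr_ge0 (a - a'); have := sqr_ge0 (b - b').
    have := sqr_ge0 (a + a'); have := sqr_ge0 (b + b').
    rewrite /sqc -/a -/b -/a' -/b' ler_norml => *; apply/andP; split; nra.
  rewrite -mulr_suml ler_pM2r ?invr_gt0//.
  under eq_bigr do rewrite mulrDr; rewrite big_split /= lerD ?sumH//.
  by rewrite -mulr_suml ler_piMl ?sqc_ge0// sum_dyadic_le1.
(* Pairing the series with its own sum T gives |T|^2 <= (H + |T|^2) / 2, hence |T|^2 <= H. *)
have TH x : G x -> sqc (T x) <= Hr x.
  move=> Gx; have : sqc (T x) <= (Hr x + sqc (T x)) / 2.
    apply: (ler_cvg_to (FT (fun=> T x) x Gx) (cvg_cst _)).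
    by apply: nearW => n; apply: le_trans (ler_norm _) (Fle _ _ _ Gx).
  lra.
have mr : measurable_fun setT (fun x => re (T x)).
  by apply: mL => // k; exact: (inL2_measurable_re (Hg k)).
have mi : measurable_fun setT (fun x => im (T x)).
  by apply: mL => // k; exact: (inL2_measurable_im (Hg k)).
have HT : inL2 mu T.
  apply/inL2P; split => //.
  apply: (le_integrable measurableT _ _ IH).
    by apply/measurable_EFinP; apply: measurable_funD; exact: measurable_funX.
  move=> x _ /=; rewrite (gee0_abs (H0 x)) ger0_norm ?sqc_ge0//.
  have [Gx|] := pselect (G x).
    by rewrite -[H x]fineK ?ge0_fin_numE// lee_fin; exact: TH.
  by rewrite /G /= => /negP; rewrite -leNgt leye_eq => /eqP ->; rewrite leey.
exists T; split => // u Hu.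
have mF n : measurable_fun setT (F u n).
  rewrite /F; apply: measurable_sum => k; apply: measurable_funM => //.
  have /integrableP[] := ip_integrable (Hg k) Hu.
  by move/measurable_EFinP.
have /inL2P[_ Iu] := Hu.
have [] := @dominated_convergence _ _ _ mu setT measurableT
  (fun n x => (F u n x)%:E) (fun x => (re (T x) * re (u x) + im (T x) * im (u x))%:E)
  (fun x => (H x + (sqc (u x))%:E)%E).
- by move=> n; exact/measurable_EFinP.
- by have /integrableP[] := ip_integrable HT Hu.
- move: aeG; apply: filterS => x Gx _; apply/cvg_EFin; first exact: nearW.
  exact: FT.
- exact: (integrableD measurableT IH Iu).
- move: aeG; apply: filterS => x Gx n _.
  rewrite -[H x]fineK ?ge0_fin_numE// -EFinD lee_fin.
  apply: le_trans (Fle _ _ _ Gx) _.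
  have : 0 <= Hr x + sqc (u x) by rewrite addr_ge0 ?sqc_ge0// fine_ge0.
  rewrite -/(Hr x); lra.
move=> _ _.
have EI v : inL2 mu v ->
    (\int[mu]_x (re (v x) * re (u x) + im (v x) * im (u x))%:E = (ip v u)%:E)%E.
  move=> Hv; rewrite ipE /Rintegral fineK//.
  exact: (integrable_fin_num measurableT (ip_integrable Hv Hu)).
rewrite EI// => /fine_cvgP[_].
apply: cvg_trans; apply: near_eq_cvg; apply: nearW => n /=.
rewrite -[RHS]/(fine (\sum_(k < n) dyadic k * ip (g k) u)%:E) -sumEFin; congr fine.
under [LHS]eq_integral do rewrite /F -sumEFin.
have Ik k := integrableZl measurableT (dyadic k) (ip_integrable (Hg k) Hu).
rewrite integral_sum//=.
apply: eq_bigr => k _; rewrite EFinM -EI// -integralZl//.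
  exact: ip_integrable.
by move=> k; exact: Ik.
Qed.

End completeness.

(** [spectral_weight] is a bare set function, with no control off the measurable sets. The integral
    sees only the fibres of simple functions, which are measurable, so it may be computed with a
    genuine measure instead. *)
Lemma eq_set_fun_integral d (T : measurableType d) (R : realType) (m1 m2 : set T -> \bar R)
    (D : set T) (f : T -> \bar R) :
  (forall A, measurable A -> m1 A = m2 A) ->
  (\int[m1]_(x in D) f x = \int[m2]_(x in D) f x)%E.
Proof.
move=> m12; have E (h : {nnsfun T >-> R}) : sintegral m1 h = sintegral m2 h.
  by apply: eq_fsbigr => r _; rewrite m12.
rewrite /integral; congr (ereal_sup _ - ereal_sup _)%E;
  by apply/seteqP; split => _ [h hf <-]; exists h.
Qed.

(** * Scalar spectral measures *)

Section spectral.
Context {R : realType} {d : measure_display} {X : measurableType d}.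
Variable mu : {measure set X -> \bar R}.
Variable E : set R -> (X -> R[i]) -> X -> R[i].
Local Notation ip := (real_inner mu).
Local Notation pvm := (projection_valued_measure mu E).
Implicit Types (f g h u v : X -> R[i]) (B C : set R) (phi psi : R -> R).

Lemma pvm_ip B f g : pvm -> measurable B -> inL2 mu f -> inL2 mu g ->
  ip (E B f) g = ip f (E B g).
Proof. by move=> P mB Hf Hg; rewrite /real_inner (pvm_sym P). Qed.

Lemma pvm_ipC B f g : pvm -> measurable B -> inL2 mu f -> inL2 mu g ->
  ip (E B f) g = ip (E B g) f.
Proof. by move=> P mB Hf Hg; rewrite pvm_ip// ipC. Qed.

Lemma pvm_ipI B C f g : pvm -> measurable B -> measurable C -> inL2 mu f -> inL2 mu g ->
  ip (E B f) (E C g) = ip (E (B `&` C) f) g.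
Proof.
move=> P mB mC Hf Hg; have HB := pvm_inL2 P mB Hf.
rewrite -(pvm_ip P mC HB Hg) setIC; apply: ip_ae => //.
- exact: pvm_inL2.
- by apply: pvm_inL2 => //; exact: measurableI.
- by have := pvm_setI P mC mB Hf; apply: filterS => x + _ => /(_ I) ->.
- exact: nearW.
Qed.

Definition pvm_form B f g : R := ip (E B f) g.

Local Notation pvmq := pvm_form.

Lemma pvmqI B f g : pvm -> measurable B -> inL2 mu f -> inL2 mu g ->
  ip (E B f) (E B g) = pvmq B f g.
Proof. by move=> *; rewrite pvm_ipI// setIid. Qed.

Lemma pvmqC B f g : pvm -> measurable B -> inL2 mu f -> inL2 mu g ->
  pvmq B f g = pvmq B g f.
Proof. by move=> *; rewrite /pvm_form pvm_ipC. Qed.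

(** Symmetry moves [E B] onto h, leaving the additivity of the inner product. *)
Lemma pvmqDl B f g h : pvm -> measurable B -> inL2 mu f -> inL2 mu g -> inL2 mu h ->
  pvmq B (fun x => f x + g x) h = pvmq B f h + pvmq B g h.
Proof.
move=> P mB Hf Hg Hh; have Hfg := inL2D Hf Hg; have HE := pvm_inL2 P mB Hh.
by rewrite /pvm_form pvm_ip// ipDl// -!pvm_ip.
Qed.

Lemma pvmqBl B f g h : pvm -> measurable B -> inL2 mu f -> inL2 mu g -> inL2 mu h ->
  pvmq B (fun x => f x - g x) h = pvmq B f h - pvmq B g h.
Proof.
move=> P mB Hf Hg Hh; have Hfg := inL2B Hf Hg; have HE := pvm_inL2 P mB Hh.
by rewrite /pvm_form pvm_ip// ipBl// -!pvm_ip.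
Qed.

Lemma pvmqD B f g : pvm -> measurable B -> inL2 mu f -> inL2 mu g ->
  pvmq B (fun x => f x + g x) (fun x => f x + g x) =
  pvmq B f f + 2 * pvmq B f g + pvmq B g g.
Proof.
move=> P mB Hf Hg; have Hfg := inL2D Hf Hg; have HEf := pvm_inL2 P mB Hf.
have HEg := pvm_inL2 P mB Hg.
rewrite pvmqDl// {1 2}/pvm_form !ipDr// -!/(pvmq _ _ _) (pvmqC _ _ Hg Hf)//; ring.
Qed.

Lemma pvmqB B f g : pvm -> measurable B -> inL2 mu f -> inL2 mu g ->
  pvmq B (fun x => f x - g x) (fun x => f x - g x) =
  pvmq B f f - 2 * pvmq B f g + pvmq B g g.
Proof.
move=> P mB Hf Hg; have Hfg := inL2B Hf Hg; have HEf := pvm_inL2 P mB Hf.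
have HEg := pvm_inL2 P mB Hg.
rewrite pvmqBl// {1 2}/pvm_form !ipBr// -!/(pvmq _ _ _) (pvmqC _ _ Hg Hf)//; ring.
Qed.

Lemma pvmq_polarization B f g : pvm -> measurable B -> inL2 mu f -> inL2 mu g ->
  pvmq B f g = (pvmq B (fun x => f x + g x) (fun x => f x + g x) -
                pvmq B (fun x => f x - g x) (fun x => f x - g x)) / 4.
Proof. by move=> *; rewrite pvmqD// pvmqB//; field. Qed.

Lemma pvmq_ge0 B f : pvm -> measurable B -> inL2 mu f -> 0 <= pvmq B f f.
Proof. by move=> *; rewrite -pvmqI// ip_ge0. Qed.

Lemma ip_il f g : inL2 mu f -> inL2 mu g ->
  ip (fun x => Complex 0 1 * f x) g = - ip f (fun x => Complex 0 1 * g x).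
Proof.
move=> Hf Hg; rewrite -mulN1r -ipZr//; last exact: inL2Z.
rewrite !ipE; apply: eq_Rintegral => x _.
by rewrite !reimE /=; ring.
Qed.

(** The imaginary part of the symmetry identity says that, inside inner products, [E B] commutes
    with multiplication by i. *)
Lemma pvmq_i B f : pvm -> measurable B -> inL2 mu f ->
  pvmq B (fun x => Complex 0 1 * f x) (fun x => Complex 0 1 * f x) = pvmq B f f.
Proof.
move=> P mB Hf.
have Hi : inL2 mu (fun x => Complex 0 1 * f x) by exact: inL2Z.
have HE := pvm_inL2 P mB Hi; have HEf := pvm_inL2 P mB Hf.
rewrite /pvm_form pvm_ip// ip_il//.
have := pvm_sym P mB Hf Hi; rewrite !innerE => -[_ <-].
by rewrite -ip_il// ip_i.
Qed.

(* Set to 0 off the measurable sets, where E B is arbitrary: a library measure has to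
   be nonnegative on every set. *)
Definition spectral_measure f B : \bar R :=
  if `[< pvm /\ inL2 mu f /\ measurable B >] then spectral_weight mu E f B else 0%E.

Local Notation nu := spectral_measure.

Lemma nuE f B : pvm -> inL2 mu f -> measurable B -> nu f B = (pvmq B f f)%:E.
Proof. by move=> P Hf mB; rewrite /spectral_measure asboolT. Qed.

Let nu_ge0 f B : (0 <= nu f B)%E.
Proof.
rewrite /spectral_measure; case: asboolP => // -[P [Hf mB]].
by rewrite lee_fin; exact: pvmq_ge0.
Qed.

Let nu_sigma_additive f : semi_sigma_additive (nu f).
Proof.
move=> F mF tF mUF; have [[P Hf]|nPf] := pselect (pvm /\ inL2 mu f).
  have := pvm_sigma_additive P Hf mF tF mUF.
  have -> : spectral_weight mu E f (\bigcup_n F n) = nu f (\bigcup_n F n).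
    by rewrite /spectral_measure asboolT.
  apply: cvg_trans; apply: near_eq_cvg; apply: nearW => n.
  by apply: eq_bigr => i _; rewrite /spectral_measure asboolT.
have nu0 B : nu f B = 0%E by rewrite /spectral_measure asboolF// => -[? [? _]]; exact: nPf.
rewrite nu0; under eq_fun do rewrite big1//; exact: cvg_cst.
Qed.

(** Countable additivity on the constant sequence of empty sets gives n c --> c; the increments, all
    equal to c, then tend to 0. *)
Let nu_set0 f : nu f set0 = 0%E.
Proof.
rewrite /spectral_measure; case: asboolP => // -[P [Hf mB]].
have := nu_sigma_additive (f := f) (F := fun=> set0).
move=> /(_ (fun=> measurable0) (@trivIset_set0 _ _ _)).
rewrite bigcup0// => /(_ measurable0).
rewrite /spectral_weight -/(ip _ _) -/(pvmq set0 f f) nuE//; set c := pvmq _ _ _ => H.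
have {}H : (n%:R * c) @[n --> \oo] --> c.
  suff /fine_cvgP[] : (n%:R * c)%:E @[n --> \oo] --> c%:E by [].
  move: H; apply: cvg_trans; apply: near_eq_cvg; apply: nearW => n.
  by rewrite sumEFin sumr_const_nat subn0 mulr_natl.
have H1 : (n.+1%:R * c - n%:R * c) @[n --> \oo] --> c - c.
  apply: cvgB => //; move: (H).
  by rewrite -(cvg_shiftS (fun n => n%:R * c)).
have H2 : (n.+1%:R * c - n%:R * c) @[n --> \oo] --> c.
  under eq_fun do rewrite -mulrBl -natr1 addrAC subrr add0r mul1r.
  exact: cvg_cst.
have := cvg_unique (@Rhausdorff R) H1 H2; rewrite subrr => <-.
by [].
Qed.

HB.instance Definition _ f := isMeasure.Build _ _ _ (nu f)
  (nu_set0 f) (nu_ge0 f) (@nu_sigma_additive f).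

Lemma integral_nu f D (phi : R -> \bar R) : pvm -> inL2 mu f ->
  (\int[spectral_weight mu E f]_(l in D) phi l = \int[nu f]_(l in D) phi l)%E.
Proof.
by move=> P Hf; apply: eq_set_fun_integral => A mA; rewrite nuE.
Qed.

Lemma nu_fin f : fin_num_fun (nu f).
Proof.
move=> B mB; rewrite /spectral_measure; case: asboolP => //.
Qed.

HB.instance Definition _ f := Measure_isFinite.Build _ _ _ (nu f) (nu_fin f).

End spectral.

Section spectral_calculus.
Context {R : realType} {d : measure_display} {X : measurableType d}.
Variable mu : {measure set X -> \bar R}.
Variable E : set R -> (X -> R[i]) -> X -> R[i].
Hypothesis P : projection_valued_measure mu E.
Local Notation ip := (real_inner mu).
Local Notation pvmq := (pvm_form mu E).
Local Notation nu := (spectral_measure mu E).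
Implicit Types (f g h u v : X -> R[i]) (B C : set R) (phi psi : R -> R).

Lemma nu_bounded_integrable f D phi (M : R) :
  measurable D -> measurable_fun D phi -> (forall l, D l -> `|phi l| <= M) ->
  (nu f).-integrable D (EFin \o phi).
Proof.
move=> mD mphi phiM; apply: (le_integrable mD _ _ (finite_measure_integrable_cst (nu f)
  `|M| mD)).
  exact/measurable_EFinP.
by move=> x Dx /=; rewrite lee_fin normr_id (le_trans (phiM _ Dx))// ler_norm.
Qed.

Definition spectral_int phi f : R := \int[nu f]_l phi l.

Local Notation Q := spectral_int.

Lemma spectral_quadE phi f : inL2 mu f -> spectral_quad mu E phi f = Q phi f.
Proof. by move=> Hf; rewrite /spectral_quad integral_nu. Qed.

Definition polar_form phi f u : R :=
  (Q phi (fun x => f x + u x) - Q phi (fun x => f x - u x)) / 4.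

Local Notation form := polar_form.

Lemma spectral_formE phi f u : inL2 mu f -> inL2 mu u ->
  spectral_form mu E phi f u =
  Complex (form phi f u) (form phi f (fun x => Complex 0 1 * u x)).
Proof.
move=> Hf Hu; have Hi := inL2Z (Complex 0 1) Hu.
by rewrite /spectral_form /polar_form !spectral_quadE//;
  [exact: inL2B|exact: inL2D|exact: inL2B|exact: inL2D].
Qed.

Lemma Q_indic B f : measurable B -> inL2 mu f -> Q (\1_B) f = pvmq B f f.
Proof.
move=> mB Hf; rewrite /spectral_int /Rintegral integral_indic// setIT;
  exact: (congr1 fine (nuE P Hf mB)).
Qed.

Lemma pvmqE B C f v : measurable B -> measurable C -> inL2 mu f -> inL2 mu v ->
  pvmq C (E B f) v = pvmq (B `&` C) f v.
Proof.
move=> mB mC Hf Hv; rewrite /pvm_form -(pvm_ipI P mB mC)//.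
by rewrite (pvm_ip P mC (pvm_inL2 P mB Hf)).
Qed.

Lemma pvmqEE B C f : measurable B -> measurable C -> inL2 mu f ->
  pvmq C (E B f) (E B f) = pvmq (B `&` C) f f.
Proof.
move=> mB mC Hf; have HE := pvm_inL2 P mB Hf; have mBC := measurableI _ _ mB mC.
by rewrite pvmqE// pvmqC// pvmqE// setIA setIid.
Qed.

Lemma nu_projD_sub B C f v : measurable B -> measurable C -> inL2 mu f -> inL2 mu v ->
  C `<=` B -> nu (fun x => E B f x + v x) C = nu (fun x => f x + v x) C.
Proof.
move=> mB mC Hf Hv CB; have HE := pvm_inL2 P mB Hf.
rewrite !nuE//; [|exact: inL2D|exact: inL2D].
rewrite !pvmqD// pvmqEE// !pvmqE// (_ : B `&` C = C)//.
exact/setIidPr.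
Qed.

Lemma nu_projB_sub B C f v : measurable B -> measurable C -> inL2 mu f -> inL2 mu v ->
  C `<=` B -> nu (fun x => E B f x - v x) C = nu (fun x => f x - v x) C.
Proof.
move=> mB mC Hf Hv CB; have HE := pvm_inL2 P mB Hf.
rewrite !nuE//; [|exact: inL2B|exact: inL2B].
rewrite !pvmqB// pvmqEE// !pvmqE// (_ : B `&` C = C)//.
exact/setIidPr.
Qed.

Lemma pvmq_set0 f v : inL2 mu f -> inL2 mu v -> pvmq set0 f v = 0.
Proof.
move=> Hf Hv; rewrite pvmq_polarization//.
have N g : inL2 mu g -> pvmq set0 g g = 0.
  by move=> Hg; have : nu g set0 = 0%E := measure0 _; rewrite nuE// => -[].
by rewrite !N ?subrr ?mul0r//; [exact: inL2B|exact: inL2D].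
Qed.

Lemma nu_projD_disj B C f v : measurable B -> measurable C -> inL2 mu f -> inL2 mu v ->
  C `<=` ~` B -> nu (fun x => E B f x + v x) C = nu v C.
Proof.
move=> mB mC Hf Hv /disjoints_subset CB; have HE := pvm_inL2 P mB Hf.
rewrite !nuE//; last exact: inL2D.
rewrite !pvmqD// pvmqEE// !pvmqE// setIC CB.
by rewrite !pvmq_set0// mulr0 !add0r.
Qed.

Lemma nu_projB_disj B C f v : measurable B -> measurable C -> inL2 mu f -> inL2 mu v ->
  C `<=` ~` B -> nu (fun x => E B f x - v x) C = nu v C.
Proof.
move=> mB mC Hf Hv /disjoints_subset CB; have HE := pvm_inL2 P mB Hf.
rewrite !nuE//; last exact: inL2B.
rewrite !pvmqB// pvmqEE// !pvmqE// setIC CB.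
by rewrite !pvmq_set0// mulr0 subrr add0r.
Qed.

(** The spectral measure of [E B f + v] is that of [f + v] inside [B] and that of [v] outside, and
    likewise with minus signs. The two outside contributions are finite and equal, so they cancel in
    the polarization difference. *)
Lemma form_proj phi B f v : measurable B -> inL2 mu f -> inL2 mu v ->
  measurable_fun setT phi ->
  (nu v).-integrable setT (EFin \o phi) ->
  (nu (fun x => f x + v x)).-integrable B (EFin \o phi) ->
  (nu (fun x => f x - v x)).-integrable B (EFin \o phi) ->
  form phi (E B f) v = (\int[nu (fun x => f x + v x)]_(l in B) phi l -
                        \int[nu (fun x => f x - v x)]_(l in B) phi l) / 4.
Proof.
move=> mB Hf Hv mphi Iv IBD IBB; have HE := pvm_inL2 P mB Hf; have mBC := measurableC mB.
have S g g' : (nu g').-integrable B (EFin \o phi) ->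
    (forall C, measurable C -> C `<=` B -> nu g C = nu g' C) ->
    (forall C, measurable C -> C `<=` ~` B -> nu g C = nu v C) ->
    Q phi g = \int[nu g']_(l in B) phi l + \int[nu v]_(l in ~` B) phi l.
  move=> IB gg' gv; rewrite /spectral_int /Rintegral -(setUv B) integral_setU//;
    last 2 first.
  - by rewrite setUv; exact/measurable_EFinP.
  - by apply/disj_setPCl.
  have -> : (\int[nu g]_(l in B) (phi l)%:E = \int[nu g']_(l in B) (phi l)%:E)%E.
    exact: eq_measure_integral.
  have -> : (\int[nu g]_(l in ~` B) (phi l)%:E = \int[nu v]_(l in ~` B) (phi l)%:E)%E.
    exact: eq_measure_integral.
  rewrite fineD//; apply: integrable_fin_num => //; exact: integrableS Iv.
rewrite /polar_form (S _ (fun x => f x + v x)); last 3 first.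
- exact: IBD.
- by move=> C mC; exact: nu_projD_sub.
- by move=> C mC; exact: nu_projD_disj.
rewrite (S _ (fun x => f x - v x)); last 3 first.
- exact: IBB.
- by move=> C mC; exact: nu_projB_sub.
- by move=> C mC; exact: nu_projB_disj.
have K (a b c : R) : a + c - (b + c) = a - b by ring.
by rewrite K.
Qed.

End spectral_calculus.

(** * Functional calculus *)

Section steps.
Context {R : realType}.
Implicit Types s : seq (R * set R).

(** Lists of (coefficient, set) pairs, with possible overlaps: one list drives both the function and
    the operator [step_operator], and sums and products are proved by induction on it. *)
Definition step_fun s (l : R) : R := \sum_(p <- s) p.1 * \1_(p.2) l.

Fixpoint measurable_steps s := if s is p :: s' then measurable p.2 /\ measurable_steps
  s' else True.

Definition mul_steps s s' := [seq (p.1 * p'.1, p.2 `&` p'.2) | p <- s, p' <- s'].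

Lemma step_prodl s s' l : step_fun (mul_steps s s') l = step_fun s l * step_fun s' l.
Proof.
rewrite /step_fun big_allpairs_dep mulr_suml; apply: eq_bigr => p _.
rewrite mulr_sumr; apply: eq_bigr => p' _ /=.
by rewrite indicI /=; ring.
Qed.

Lemma wf_cat s s' : measurable_steps s -> measurable_steps s' -> measurable_steps (s ++ s').
Proof. by elim: s => //= p s IH [mp ws] ws'; split => //; exact: IH. Qed.

Lemma wf_prodl s s' : measurable_steps s -> measurable_steps s' -> measurable_steps
  (mul_steps s s').
Proof.
move=> + ws'; elim: s => //= p s IH [mp ws]; apply: wf_cat; last exact: IH.
by elim: s' ws' {IH} => //= p' s' IH [mp' ws']; split; [exact: measurableI|exact: IH].
Qed.

Lemma measurable_step s : measurable_steps s -> measurable_fun setT (step_fun s).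
Proof.
rewrite /step_fun; elim: s => [_|p s IH /= [mp ws]].
  by under eq_fun do rewrite big_nil; exact: measurable_cst.
under eq_fun do rewrite big_cons.
apply: measurable_funD; last exact: IH.
by apply: measurable_funM => //; exact: measurable_indic.
Qed.

Lemma step_bounded s : exists M, forall l, `|step_fun s l| <= M.
Proof.
exists (\sum_(p <- s) `|p.1|) => l; apply: le_trans (ler_norm_sum _ _ _) _.
apply: ler_sum => p _; rewrite normrM indicE.
by case: (_ \in _); rewrite /= ?normr1 ?normr0 ?mulr1 ?mulr0.
Qed.

Lemma nnsfun_step (a : {nnsfun R >-> R}) : exists2 s, measurable_steps s & forall l,
  step_fun s l = a l.
Proof.
exists [seq (r, a @^-1` [set r]) | r <- finmap.enum_fset (fset_set (range a))].
  by elim: (finmap.enum_fset _) => //= r s IH; split => //; exact: measurable_sfunP.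
by move=> l; rewrite /step_fun big_map fimfunE fsbig_finite//=; exact: fimfunP.
Qed.

Lemma step_approx (a : R -> R) : measurable_fun setT a -> (forall l, 0 <= a l) ->
  exists s : nat -> seq (R * set R), [/\ forall n, measurable_steps (s n),
    forall n l, 0 <= step_fun (s n) l <= a l,
    forall l, nondecreasing_seq (fun n => step_fun (s n) l) &
    forall l, step_fun (s n) l @[n --> \oo] --> a l].
Proof.
move=> ma a0; have ma' : measurable_fun setT (EFin \o a) by exact/measurable_EFinP.
pose ap := nnsfun_approx measurableT ma'.
have /choice[s Hs] n : exists s, measurable_steps s /\ forall l, step_fun s l = ap n l.
  by have [s ? ?] := nnsfun_step (ap n); exists s.
have nd l : nondecreasing_seq (fun n => step_fun (s n) l).
  move=> m n mn; rewrite (Hs m).2 (Hs n).2.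
  by have /lefP := nd_nnsfun_approx measurableT ma' mn; apply.
have cv l : step_fun (s n) l @[n --> \oo] --> a l.
  have : (ap n l)%:E @[n --> \oo] --> (EFin \o a) l.
    by apply: cvg_nnsfun_approx => // x _; rewrite lee_fin.
  move/fine_cvgP => [_]; apply: cvg_trans; apply: near_eq_cvg; apply: nearW => n /=.
  by rewrite (Hs n).2.
exists s; split => //; first by move=> n; exact: (Hs n).1.
move=> n l; apply/andP; split; first by rewrite (Hs n).2.
by have := nondecreasing_cvgn_le (nd l) (cvgP _ (cv l)) n; rewrite (cvg_lim _ (cv l)).
Qed.

End steps.

Section step_operators.
Context {R : realType} {d : measure_display} {X : measurableType d}.
Variable mu : {measure set X -> \bar R}.
Variable E : set R -> (X -> R[i]) -> X -> R[i].
Hypothesis P : projection_valued_measure mu E.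
Local Notation ip := (real_inner mu).
Local Notation pvmq := (pvm_form mu E).
Local Notation nu := (spectral_measure mu E).
Local Notation Q := (spectral_int mu E).
Local Notation form := (polar_form mu E).
Implicit Types (f g h u v : X -> R[i]) (B C : set R) (phi psi : R -> R).

Fixpoint step_operator (s : seq (R * set R)) f : X -> R[i] :=
  if s is p :: s' then fun x => Complex p.1 0 * E p.2 f x + step_operator s' f x else
    fun=> 0.

Lemma inL2_Sop s f : measurable_steps s -> inL2 mu f -> inL2 mu (step_operator s f).
Proof.
move=> + Hf; elim: s => [_|p s IH /= [mp ws]]; first exact: inL2_0.
by apply: inL2_lin; [exact: (pvm_inL2 P)|exact: IH].
Qed.

Lemma ip_Sop s f u : measurable_steps s -> inL2 mu f -> inL2 mu u ->
  ip (step_operator s f) u = \sum_(p <- s) p.1 * ip (E p.2 f) u.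
Proof.
move=> + Hf Hu; elim: s => [_|p s IH /= [mp ws]]; first by rewrite big_nil ip0l.
rewrite ip_linl// ?big_cons ?IH//; first exact: (pvm_inL2 P).
exact: inL2_Sop.
Qed.

(** Multiplicativity of E. Combined with [Q_step], the case of equal lists and u = f is |s(A) f|^2 =
    \int s^2 dnu_f. *)
Lemma ip_SopS s s' f u : measurable_steps s -> measurable_steps s' -> inL2 mu f -> inL2
  mu u ->
  ip (step_operator s f) (step_operator s' u) = ip (step_operator (mul_steps s s') f) u.
Proof.
move=> ws ws' Hf Hu; have HS := inL2_Sop ws' Hu.
rewrite !ip_Sop//; last exact: wf_prodl.
rewrite big_allpairs_dep.
elim: s ws => [|p s IH /= [mp ws]]; first by rewrite !big_nil.
rewrite !big_cons IH//; congr (_ + _).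
rewrite ipC ip_Sop//; last exact: (pvm_inL2 P).
rewrite mulr_sumr; elim: s' ws' {IH HS} => [|p' s' IH /= [mp' ws']];
  first by rewrite !big_nil.
by rewrite !big_cons IH// mulrA ipC pvm_ipI.
Qed.

Lemma step_integrable s f : measurable_steps s -> (nu f).-integrable setT (EFin \o
  step_fun s).
Proof.
move=> ws; have [M sM] := step_bounded s.
by apply: (nu_bounded_integrable mu E f measurableT (measurable_step ws)) => l _; exact: sM.
Qed.

Lemma Q_step s f : measurable_steps s -> inL2 mu f -> Q (step_fun s) f = ip
  (step_operator s f) f.
Proof.
move=> + Hf; elim: s => [_|p s IH /= [mp ws]].
  rewrite ip0l /spectral_int /Rintegral; under eq_integral do rewrite /step_fun big_nil.
  by rewrite integral0.
rewrite ip_linl//; [|exact: (pvm_inL2 P)|exact: inL2_Sop].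
rewrite -IH// -/(pvmq p.2 f f) -(Q_indic P)// /spectral_int.
have I1 : (nu f).-integrable setT (EFin \o \1_(p.2)).
  by apply: (@nu_bounded_integrable _ _ _ _ _ _ _ _ 1) => // l _; rewrite indicE;
    case: (_ \in _); rewrite ?normr1 ?normr0.
rewrite -RintegralZl// -RintegralD//; last exact: step_integrable.
  by apply: eq_Rintegral => l _; rewrite /step_fun big_cons.
by have := integrableZl measurableT p.1 I1; apply: eq_integrable.
Qed.

Lemma form_step s f u : measurable_steps s -> inL2 mu f -> inL2 mu u ->
  form (step_fun s) f u = ip (step_operator s f) u.
Proof.
move=> ws Hf Hu; have Hp := inL2D Hf Hu; have Hm := inL2B Hf Hu.
rewrite /polar_form !Q_step// !ip_Sop// -sumrB mulr_suml; move: ws.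
elim: s => [_|p s IH /= [mp ws]]; first by rewrite !big_nil.
rewrite !big_cons IH//; congr (_ + _).
by rewrite -!/(pvmq _ _ _) -mulrBr -mulrA -pvmq_polarization.
Qed.

End step_operators.

Section greedy.
Context {R : realType}.
Variable phi : R -> R.

(* Greedy binary digits: phi = \sum_k 2^-(k+1) 1_(greedy_set k) uniformly, so that
   phi(A) f is the dyadic series of the vectors E (greedy_set k) f. *)
Fixpoint greedy (n : nat) : R -> R :=
  if n is m.+1 then
    fun l => greedy m l + dyadic m * \1_[set l | greedy m l + dyadic m <= phi l] l
  else fun=> 0.

Definition greedy_set n := [set l | greedy n l + dyadic n <= phi l].

Definition greedy_list n := [seq (dyadic k : R, greedy_set k) | k <- iota 0 n].

Hypothesis mphi : measurable_fun setT phi.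

Lemma measurable_greedy_set n : measurable_fun setT (greedy n) -> measurable (greedy_set n).
Proof.
move=> mg; rewrite /greedy_set.
have := measurable_fun_ler (measurable_funD mg (measurable_cst (dyadic n : R))) mphi.
by move=> /(_ measurableT [set true] I); rewrite setTI.
Qed.

Lemma measurable_greedy n : measurable_fun setT (greedy n).
Proof.
elim: n => [|n IH] /=; first exact: measurable_cst.
apply: measurable_funD => //; apply: measurable_funM => //.
by apply: measurable_indic; exact: measurable_greedy_set.
Qed.

Lemma wf_greedy_list n : measurable_steps (greedy_list n).
Proof.
rewrite /greedy_list; elim: (iota 0 n) => //= k s IH; split => //.
by apply: measurable_greedy_set; exact: measurable_greedy.
Qed.

Lemma step_greedy_list n l : step_fun (greedy_list n) l = greedy n l.
Proof.
rewrite /step_fun big_map -{1}[n]subn0 -/(index_iota 0 n).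
elim: n => [|n IH]; first by rewrite big_geq.
by rewrite big_nat_recr//= IH.
Qed.

Hypothesis phi01 : forall l, 0 <= phi l <= 1.

(** A digit is taken exactly when the remainder is at least half of its current bound 2^-n, so the
    bound is halved in both cases. *)
Lemma greedy_bound n l : 0 <= greedy n l /\ 0 <= phi l - greedy n l <= 2 ^- n.
Proof.
elim: n => [|n [IH0 /andP[IH1 IH2]]] /=; first by rewrite subr0 expr0 invr1.
have dn := dyadic_gt0 n (R := R).
have dy2 : 2 ^- n = dyadic n + dyadic n :> R.
  by rewrite /dyadic exprS invfM; field; rewrite expf_neq0.
rewrite -/(dyadic n); case: (boolP (l \in [set l | greedy n l + dyadic n <= phi l])) =>
  H; rewrite indicE.
- rewrite H /=; move: (set_mem H) => /= {}H; split; first by rewrite addr_ge0// mulr1 ltW.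
  apply/andP; split; lra.
- rewrite (negbTE H) /=; move: (H); rewrite notin_setE /= => /negP; rewrite -ltNge => {}H.
  split; first lra.
  apply/andP; split; lra.
Qed.

Lemma greedy_cvg l : greedy n l @[n --> \oo] --> phi l.
Proof.
have H n := greedy_bound n l.
apply/subr_cvg0; apply: (@squeeze_cvgr _ _ _ _ (fun n => - (2 ^- n)) (fun n => 0)) => //.
- by apply: nearW => n; have [_ /andP[h1 h2]] := H n; apply/andP; split; lra.
- rewrite -oppr0; apply: cvgN; under eq_fun do rewrite -exprVn.
  by apply: cvg_expr; rewrite gtr0_norm ?invr_gt0// invf_lt1// ltr1n.
- exact: cvg_cst.
Qed.

End greedy.

Section functional_calculus.
Context {R : realType} {d : measure_display} {X : measurableType d}.
Variable mu : {measure set X -> \bar R}.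
Variable E : set R -> (X -> R[i]) -> X -> R[i].
Hypothesis P : projection_valued_measure mu E.
Local Notation ip := (real_inner mu).
Local Notation pvmq := (pvm_form mu E).
Local Notation nu := (spectral_measure mu E).
Local Notation Q := (spectral_int mu E).
Local Notation form := (polar_form mu E).
Implicit Types (f g h u v : X -> R[i]) (B C : set R) (phi psi : R -> R).

Lemma Q_dominated_cvg (a : nat -> R -> R) phi psi f :
  (forall n, measurable_fun setT (a n)) -> measurable_fun setT phi ->
  (forall l, a n l @[n --> \oo] --> phi l) ->
  (nu f).-integrable setT (EFin \o psi) -> (forall n l, `|a n l| <= psi l) ->
  Q (a n) f @[n --> \oo] --> Q phi f.
Proof.
move=> ma mphi acvg Ipsi apsi.
have [|||||_ _] := @dominated_convergence _ _ _ (nu f) setT measurableT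
    (fun n l => (a n l)%:E) (EFin \o phi) (EFin \o psi) => //.
- by move=> n; exact/measurable_EFinP.
- exact/measurable_EFinP.
- by apply: nearW => l _; apply/cvg_EFin; [exact: nearW|exact: acvg].
- by apply: nearW => l n _ /=; rewrite lee_fin.
move=> H; rewrite /spectral_int /Rintegral.
have Iphi : (nu f).-integrable setT (EFin \o phi).
  apply: (le_integrable measurableT _ _ Ipsi); first exact/measurable_EFinP.
  move=> l _ /=; rewrite lee_fin; apply: le_trans (ler_norm _).
  apply: (ler_cvg_to (cvg_norm (acvg l)) (cvg_cst _)); exact: nearW.
suff /fine_cvgP[] : (\int[nu f]_l (a n l)%:E)%E @[n --> \oo] -->
    (fine (\int[nu f]_l (phi l)%:E))%:E by [].
by rewrite fineK//; exact: integrable_fin_num.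
Qed.

Lemma form_dominated_cvg (a : nat -> R -> R) phi psi f u :
  (forall n, measurable_fun setT (a n)) -> measurable_fun setT phi ->
  (forall l, a n l @[n --> \oo] --> phi l) ->
  (nu (fun x => f x + u x)).-integrable setT (EFin \o psi) ->
  (nu (fun x => f x - u x)).-integrable setT (EFin \o psi) ->
  (forall n l, `|a n l| <= psi l) ->
  form (a n) f u @[n --> \oo] --> form phi f u.
Proof.
move=> ma mphi acvg Ip Im apsi.
apply: cvgM; last exact: cvg_cst.
have Qp := Q_dominated_cvg ma mphi acvg Ip apsi.
have Qm := Q_dominated_cvg ma mphi acvg Im apsi.
exact: cvgB Qp Qm.
Qed.

Lemma integrable_cst1 f : (nu f).-integrable setT (EFin \o cst 1).
Proof. exact: finite_measure_integrable_cst. Qed.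

Lemma le_Q phi psi f : (nu f).-integrable setT (EFin \o phi) ->
  (nu f).-integrable setT (EFin \o psi) -> (forall l, phi l <= psi l) ->
  Q phi f <= Q psi f.
Proof. by move=> I1 I2 H; apply: le_Rintegral. Qed.

Lemma pvmqT f u : inL2 mu f -> inL2 mu u -> pvmq setT f u = ip f u.
Proof.
move=> Hf Hu; apply: ip_ae => //; [exact: (pvm_inL2 P)|exact: (pvm_setT P)|exact: nearW].
Qed.

Lemma pvmq_le_ip B f : measurable B -> inL2 mu f -> pvmq B f f <= ip f f.
Proof.
move=> mB Hf; rewrite -(pvmqT Hf Hf) -lee_fin -!(nuE P)//.
by apply: le_measure; rewrite ?inE.
Qed.

(** The vector phi(A) f is the weak dyadic sum of the projections of f on the digit sets. Dominated
    convergence identifies its inner products. Weak convergence gives only an inequality for its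
    norm: Cauchy-Schwarz on the partial sums tends to |T|^4 <= Q(phi^2) |T|^2, and one divides by
    |T|^2. *)
Lemma bounded_calculus phi f : measurable_fun setT phi ->
  (forall l, 0 <= phi l <= 1) -> inL2 mu f ->
  exists T, [/\ inL2 mu T, forall u, inL2 mu u -> ip T u = form phi f u &
    ip T T <= Q (fun l => phi l ^+ 2) f].
Proof.
move=> mphi phi01 Hf.
have mA k : measurable (greedy_set phi k).
  by apply: measurable_greedy_set => //; exact: measurable_greedy.
have ws n : measurable_steps (greedy_list phi n) by exact: wf_greedy_list.
have [|k|T [HT T_cvg]] := @L2_dyadic_series _ _ _ mu (fun k => E (greedy_set phi k) f)
  (ip f f).
- by move=> k; exact: (pvm_inL2 P).
- by rewrite (pvmqI P)//; exact: pvmq_le_ip.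
have IPS n u : inL2 mu u -> ip (step_operator E (greedy_list phi n) f) u = \sum_(k < n)
  dyadic k * ip (E (greedy_set phi k) f) u.
  move=> Hu; rewrite (ip_Sop P)// big_map -(big_mkord xpredT (fun k => dyadic k * ip (E
    (greedy_set phi k) f) u)).
  by rewrite /index_iota subn0.
have abs1 (a : R -> R) (a01 : forall l, 0 <= a l <= 1) l : `|a l| <= 1.
  by have /andP[? ?] := a01 l; rewrite ger0_norm.
have gr01 n l : 0 <= greedy phi n l <= phi l.
  have [-> /andP[+ _]] := greedy_bound phi01 n l.
  by rewrite subr_ge0.
have gr1 n l : `|greedy phi n l| <= 1.
  by apply: abs1 => {}l; have /andP[-> /le_trans->//] := gr01 n l; have /andP[] := phi01 l.
exists T; split => //.
  move=> u Hu; have Hp := inL2D Hf Hu; have Hm := inL2B Hf Hu.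
  apply: (cvg_unique (@Rhausdorff R) (T_cvg u Hu)).
  have := form_dominated_cvg (measurable_greedy mphi) mphi (greedy_cvg phi01)
    (integrable_cst1 _) (integrable_cst1 _) gr1.
  move=> /(_ f u); apply: cvg_trans; apply: near_eq_cvg; apply: nearW => n.
  rewrite -IPS// -(form_step P)//; congr (form _ _ _).
  by apply/funext => l; rewrite step_greedy_list.
have Tn n : ip (step_operator E (greedy_list phi n) f) T ^+ 2 <= Q (fun l => phi l ^+
  2) f * ip T T.
  have HS := inL2_Sop P (ws n) Hf.
  apply: le_trans (ip_cauchy_schwarz HS HT) _; apply: ler_wpM2r; first exact: ip_ge0.
  rewrite (ip_SopS P)// -(Q_step P)//; last exact: wf_prodl.
  apply: le_Q.
  - by apply: step_integrable; exact: wf_prodl.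
  - apply: (nu_bounded_integrable mu E f measurableT (M := 1));
    first exact: measurable_funX.
    move=> l _; rewrite normrX expr_le1//; exact: abs1.
  - move=> l; rewrite step_prodl step_greedy_list -expr2.
    by have /andP[h1 h2] := gr01 n l; rewrite lerXn2r// nnegrE// (le_trans h1).
have H : ip T T ^+ 2 <= Q (fun l => phi l ^+ 2) f * ip T T.
  have := T_cvg T HT => /(fun c => cvgM c c) c.
  apply: (ler_cvg_to c (cvg_cst _)); apply: nearW => n /=.
  by rewrite -expr2 -IPS.
have := ip_ge0 mu T; rewrite le_eqVlt => /predU1P[<-|T0].
  by apply: Rintegral_ge0 => l _; exact: sqr_ge0.
by rewrite -(ler_pM2r T0) -expr2.
Qed.

End functional_calculus.

(** * Domains and weak spectral integrals *)

Section resolution.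
Context {R : realType} {d : measure_display} {X : measurableType d}.
Variable mu : {measure set X -> \bar R}.
Variable E : set R -> (X -> R[i]) -> X -> R[i].
Hypothesis P : projection_valued_measure mu E.
Local Notation ip := (real_inner mu).
Local Notation pvmq := (pvm_form mu E).
Local Notation nu := (spectral_measure mu E).
Local Notation Q := (spectral_int mu E).
Local Notation form := (polar_form mu E).
Implicit Types (f g h u v : X -> R[i]) (B C : set R) (phi psi : R -> R).

(** The vectors f - u and u - f have the same spectral measure. *)
Lemma formC phi f u : inL2 mu f -> inL2 mu u -> form phi f u = form phi u f.
Proof.
move=> Hf Hu; have -> : form phi f u = (Q phi (fun x => u x + f x) - Q phi (fun x => f
  x - u x)) / 4.
  by rewrite /polar_form; under [in LHS]eq_fun do rewrite addrC.
suff -> : Q phi (fun x => f x - u x) = Q phi (fun x => u x - f x) by [].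
apply: (congr1 fine); apply: eq_measure_integral => C mC _.
apply: (etrans (nuE P (inL2B Hf Hu) mC)); apply: (etrans _ (esym (nuE P (inL2B Hu Hf) mC))).
by rewrite !(pvmqB P)// (pvmqC P mC Hu Hf); congr (_%:E); ring.
Qed.

Lemma integral_nu_double phi f D : measurable_fun setT phi -> (forall l, 0 <= phi l) ->
  measurable D -> inL2 mu f ->
  (\int[nu (fun x => f x + f x)%R]_(l in D) (phi l)%:E = 4%:E * \int[nu f]_(l in D)
    (phi l)%:E)%E.
Proof.
move=> mphi phi0 mD Hf; have n4 : 0 <= 4 :> R by [].
rewrite -[X in (X%:E * _)%E]/((NngNum n4)%:num) -ge0_integral_mscale//; last 2 first.
- by apply/measurable_EFinP; exact: measurable_funTS.
- by move=> l _; rewrite lee_fin.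
apply: eq_measure_integral => C mC _.
apply: (etrans (nuE P (inL2D Hf Hf) mC)); apply: esym.
apply: (etrans (congr1 (fun z => 4%:E * z)%E (nuE P Hf mC))).
by rewrite (pvmqD P mC Hf Hf) -EFinM; congr (_%:E); ring.
Qed.

Lemma integral_nu_zero phi f D : inL2 mu f ->
  (\int[nu (fun x => f x - f x)%R]_(l in D) (phi l)%:E = 0)%E.
Proof.
move=> Hf; rewrite -(integral_measure_zero D (EFin \o phi));
  apply: eq_measure_integral => C mC _.
apply: (etrans (nuE P (inL2B Hf Hf) mC)).
by rewrite (pvmqB P mC Hf Hf) /mzero; congr (_%:E); ring.
Qed.

Lemma form_diag phi f : measurable_fun setT phi -> (forall l, 0 <= phi l) ->
  inL2 mu f -> form phi f f = Q phi f.
Proof.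
move=> mphi phi0 Hf; rewrite /polar_form {1 2}/spectral_int /Rintegral.
rewrite (integral_nu_double mphi phi0 measurableT Hf) integral_nu_zero// subr0.
rewrite /spectral_int /Rintegral; have : (0 <= \int[nu f]_l (phi l)%:E)%E.
  by apply: integral_ge0 => l _; rewrite lee_fin.
(* If the integral is infinite, [fine] returns 0 on both sides, so no integrability is asked for. *)
case: (\int[nu f]_l _)%E => [r||]//= _; first by field.
by rewrite gt0_muley ?lte_fin//= mul0r.
Qed.

(** [nu f] is finite and |phi| <= 1 + phi^2. *)
Lemma spectral_dom_integrable phi f : measurable_fun setT phi ->
  spectral_dom mu E phi f -> (nu f).-integrable setT (EFin \o phi).
Proof.
move=> mphi [Hf]; rewrite integral_nu// => I2.
have I3 : (nu f).-integrable setT (fun l => (phi l ^+ 2)%:E).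
  apply/integrableP; split; first by apply/measurable_EFinP; exact: measurable_funX.
  by under eq_integral do rewrite gee0_abs ?lee_fin ?sqr_ge0//.
have I := integrableD measurableT (integrable_cst1 mu E f) I3.
apply: (le_integrable measurableT _ _ I); first exact/measurable_EFinP.
move=> l _ /=; rewrite lee_fin [leRHS]ger0_norm ?addr_ge0 ?sqr_ge0// ler_norml.
have := sqr_ge0 (phi l - 1); have := sqr_ge0 (phi l + 1).
by move=> *; apply/andP; split; nra.
Qed.

Lemma spectral_dom_i phi f : spectral_dom mu E phi f ->
  spectral_dom mu E phi (fun x => Complex 0 1 * f x).
Proof.
move=> [Hf I]; have Hi := inL2Z (Complex 0 1) Hf; split; first exact: Hi.
apply: le_lt_trans I; rewrite (integral_nu _ _ P Hi) (integral_nu _ _ P Hf) le_eqVlt; apply/orP; left; apply/eqP.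
apply: eq_measure_integral => C mC _.
apply: (etrans (nuE P Hi mC)); apply: esym; apply: (etrans (nuE P Hf mC)).
by rewrite (pvmq_i P).
Qed.

Lemma nu_proj B C f : measurable B -> measurable C -> inL2 mu f ->
  nu (E B f) C = nu f (B `&` C).
Proof.
move=> mB mC Hf; rewrite (nuE P (pvm_inL2 P mB Hf) mC) (nuE P Hf (measurableI _ _ mB mC)).
by rewrite (pvmqEE P).
Qed.

Lemma Q_restrict B phi f : Q (phi \_ B) f = \int[nu f]_(l in B) phi l.
Proof. by rewrite /spectral_int [RHS]Rintegral_mkcond. Qed.

Lemma measurable_patch B phi : measurable B -> measurable_fun setT phi ->
  measurable_fun setT (phi \_ B).
Proof.
move=> mB mphi; apply: (iffLR (measurable_restrictT phi mB)); exact: measurable_funTS.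
Qed.

(** The source of vectors in the domain of phi(A): on [B] the function phi / c takes values in
    [0, 1], so [bounded_calculus] applies to it after cutting off, and the result is scaled back.
    The constant c may be negative, which is how the negative half-line is reached. *)
Lemma spectral_integral_proj phi B (c : R) f : measurable_fun setT phi -> measurable B ->
  c != 0 -> (forall l, B l -> 0 <= phi l / c <= 1) -> inL2 mu f ->
  exists g, [/\ spectral_integral mu E phi (E B f) g,
    forall u, inL2 mu u -> ip g u = form (phi \_ B) f u &
    ip g g <= Q (fun l => (phi \_ B) l ^+ 2) f].
Proof.
move=> mphi mB c0 phic Hf; have HE := pvm_inL2 P mB Hf.
pose psi l := (phi \_ B) l / c.
have mphiB := measurable_patch mB mphi.
have mpsi : measurable_fun setT psi by exact: measurable_funM.
have psi01 l : 0 <= psi l <= 1.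
  rewrite /psi patchE; case: ifPn => [/set_mem/phic//|_].
  by rewrite mul0r lexx ler01.
have psiE : phi \_ B = (fun l => c * psi l).
  by apply/funext => l; rewrite /psi mulrC divfK.
move: psi mpsi psi01 psiE => psi mpsi psi01 psiE.
have [T [HT ipT TT]] := bounded_calculus P mpsi psi01 Hf.
have Ipsi w : (nu w).-integrable setT (EFin \o psi).
  apply: (nu_bounded_integrable mu E w measurableT mpsi (M := 1)) => l _.
  by have /andP[h1 h2] := psi01 l; rewrite ger0_norm.
have Qpsi w : Q (phi \_ B) w = c * Q psi w by rewrite psiE /spectral_int RintegralZl//;
  exact: Ipsi.
pose g x := Complex c 0 * T x.
have Hg : inL2 mu g by exact: inL2Z.
have ipg u : inL2 mu u -> ip g u = form (phi \_ B) f u.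
  by move=> Hu; rewrite /g ipZl// ipT// /polar_form !Qpsi -mulrBr mulrA.
exists g; split => //; last first.
  rewrite /g ipZl// ipZr//.
  apply: (@le_trans _ _ (c * (c * Q (fun l => psi l ^+ 2) f))).
    by rewrite !mulrA -expr2 ler_wpM2l// sqr_ge0.
  rewrite psiE /spectral_int; under [leRHS]eq_Rintegral do rewrite exprMn.
  rewrite RintegralZl ?expr2 ?mulrA//.
  apply: (nu_bounded_integrable mu E f measurableT (M := 1)); first exact: measurable_funX.
  move=> l _; have /andP[h1 h2] := psi01 l.
  by rewrite ger0_norm ?sqr_ge0// expr_le1.
have IB w : (nu w).-integrable B (EFin \o phi).
  apply: (nu_bounded_integrable mu E w mB (M := `|c|)); first exact: measurable_funTS.
  move=> l /phic /andP[h1 h2].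
  by rewrite -[phi l](divfK c0) normrM ler_piMl// ger0_norm.
split => //.
- split => //; rewrite integral_nu//.
  rewrite -(setUv B) ge0_integral_setU//=; last 4 first.
  + exact: measurableC.
  + rewrite setUv; apply/measurable_EFinP; exact: measurable_funX.
  + by move=> l _; rewrite lee_fin sqr_ge0.
  + by apply/disj_setPCl.
  (* The spectral measure of [E B f] does not charge the complement of [B]. *)
  rewrite [X in (_ + X)%E](_ : _ = 0%E) ?adde0; last first.
    have -> : (\int[nu (E B f)]_(l in ~` B) (phi l ^+ 2)%:E = \int[mzero]_(l in ~` B)
      (phi l ^+ 2)%:E)%E.
      apply: eq_measure_integral => C mC CB.
      apply: (etrans (nu_proj mB mC Hf)).
      by move/disjoints_subset: CB; rewrite setIC => ->; rewrite measure0.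
    exact: integral_measure_zero.
  have : (nu (E B f)).-integrable B (EFin \o (fun l => phi l ^+ 2)).
    apply: (nu_bounded_integrable mu E _ mB (M := `|c| ^+ 2)).
      by apply: measurable_funX; exact: measurable_funTS.
    move=> l /phic /andP[h1 h2].
    rewrite normrX lerXn2r// ?nnegrE//.
    by rewrite -[phi l](divfK c0) normrM ler_piMl// ger0_norm.
  by move=> /(integrable_lty mB).
- move=> h Dh; have [Hh _] := Dh; have [Hih _] := spectral_dom_i Dh.
  have fp v : spectral_dom mu E phi v -> form (phi \_ B) f v = form phi (E B f) v.
    move=> Dv; have [Hv _] := Dv.
    rewrite (form_proj P mB Hf Hv mphi (spectral_dom_integrable mphi Dv) (IB _) (IB _)).
    by rewrite /polar_form !Q_restrict.
  by rewrite innerE (spectral_formE P phi HE Hh) (ipg _ Hh) (ipg _ Hih) (fp _ Dh) (fp _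
    (spectral_dom_i Dh)).
Qed.

(** The integrability conditions of [form_proj] hold because f + f has spectral measure 4 [nu f] and
    f - f has spectral measure 0. *)
Lemma form_proj_diag phi B f : measurable_fun setT phi -> measurable B ->
  (forall l, B l -> 0 <= phi l) -> inL2 mu f ->
  (nu f).-integrable setT (EFin \o phi) ->
  form phi (E B f) f = Q (phi \_ B) f.
Proof.
move=> mphi mB phi0 Hf If.
have mphiB := measurable_patch mB mphi.
have phiB0 l : 0 <= (phi \_ B) l by rewrite patchE; case: ifPn => // /set_mem/phi0.
have IB w : (nu w).-integrable setT (EFin \o (phi \_ B)) -> (nu w).-integrable B (EFin
  \o phi).
  by move=> I; apply/(integrable_mkcond _ mB); rewrite restrict_EFin.
have If' : (nu f).-integrable setT (EFin \o (phi \_ B)).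
  rewrite -restrict_EFin; apply: (iffLR (integrable_mkcond _ mB)).
  exact: integrableS If.
have Ip : (nu (fun x => f x + f x)).-integrable setT (EFin \o (phi \_ B)).
  apply/integrableP; split; first exact/measurable_EFinP.
  under eq_integral do rewrite /= ger0_norm//.
  rewrite (integral_nu_double mphiB phiB0 measurableT Hf).
  have := integrable_fin_num measurableT If'.
  by move=> /fineK <-; rewrite -EFinM ltry.
have Im : (nu (fun x => f x - f x)).-integrable setT (EFin \o (phi \_ B)).
  apply/integrableP; split; first exact/measurable_EFinP.
  under eq_integral do rewrite /= ger0_norm//.
  by rewrite integral_nu_zero.
rewrite -(form_diag mphiB phiB0 Hf) (form_proj P mB Hf Hf mphi If (IB _ Ip) (IB _ Im)).
by rewrite /polar_form !Q_restrict.
Qed.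

End resolution.

(** * Spectrum, kernel and projection of a positive operator *)

Section positive_resolution.
Context {R : realType} {d : measure_display} {X : measurableType d}.
Variable mu : {measure set X -> \bar R}.
Variables (A : graph R X) (E : set R -> (X -> R[i]) -> X -> R[i]).
Hypothesis A_selfadjoint : selfadjoint mu A.
Hypothesis A_positive : positive_operator mu A.
Hypothesis A_resolution : spectral_resolution mu A E.
Local Notation ip := (real_inner mu).
Local Notation pvmq := (pvm_form mu E).
Local Notation nu := (spectral_measure mu E).
Local Notation Q := (spectral_int mu E).
Local Notation form := (polar_form mu E).
Implicit Types (f g h u v : X -> R[i]) (B C : set R) (phi psi : R -> R).

Let P : projection_valued_measure mu E := A_resolution.1.

Lemma measurable_idR : measurable_fun setT (fun l : R => l).
Proof. exact: measurable_id. Qed.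

Lemma le_pvmq_Q c B phi f : measurable B -> inL2 mu f ->
  (nu f).-integrable setT (EFin \o phi) -> (forall l, c * \1_B l <= phi l) ->
  c * pvmq B f f <= Q phi f.
Proof.
move=> mB Hf If H.
have I1 : (nu f).-integrable setT (EFin \o \1_B).
  apply: (nu_bounded_integrable mu E f measurableT (M := 1)) => // l _.
  by rewrite indicE; case: (_ \in _); rewrite ?normr1 ?normr0.
rewrite -(Q_indic P mB Hf) /spectral_int -RintegralZl//; apply: le_Q => //.
by have := integrableZl measurableT c I1; apply: eq_integrable.
Qed.

Lemma pvmq_bigcup0 (B : nat -> set R) C f : measurable C -> (forall n, measurable (B n)) ->
  inL2 mu f -> (forall n, pvmq (B n) f f = 0) -> C `<=` \bigcup_n B n ->
  pvmq C f f = 0.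
Proof.
move=> mC mB Hf B0 CB.
have : (nu f C <= \sum_(n <oo) nu f (B n))%E by exact: measure_sigma_subadditive.
rewrite eseries0; last by move=> n _ _; rewrite (nuE P Hf (mB n)) B0.
rewrite (nuE P Hf mC) lee_fin => C0.
by apply/eqP; rewrite eq_le C0 (pvmq_ge0 P).
Qed.

(** The bands [1/(n+1), n+1] exhaust the positive half-line. On each of them l is bounded, so
    projected vectors lie in the domain of A, and it is bounded away from 0, so a nonpositive
    integral of l forces the mass to vanish. *)
Lemma band_bound (n : nat) (l : R) : n.+1%:R^-1 <= l <= n.+1%:R ->
  [/\ 0 <= l, 0 <= l <= n.+1%:R & 0 <= l / n.+1%:R <= 1].
Proof.
move=> /andP[l1 l2]; have l0 : 0 <= l by apply: le_trans l1; rewrite invr_ge0.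
by rewrite l0 l2 divr_ge0//= ler_pdivrMr// mul1r.
Qed.

Lemma pos_band (l : R) : 0 < l -> exists n : nat, n.+1%:R^-1 <= l <= n.+1%:R.
Proof.
move=> l0; set m := Num.max l l^-1; exists (Num.truncn m).
have m0 : 0 <= m by rewrite le_max ltW.
have := truncnS_gt m.
rewrite -/m gt_max => /andP[h1 h2]; apply/andP; split; last exact: ltW.
by rewrite -[leRHS]invrK lef_pV2 ?posrE ?invr_gt0//; exact: ltW.
Qed.

(** On the reflected band B the vector E(B) f is in the domain of A, and positivity gives \int_B l
    dnu_f >= 0, although l <= -1/(n+1) there. *)
Lemma pvmq_neg f : inL2 mu f -> pvmq `]-oo, 0[ f f = 0.
Proof.
move=> Hf; pose B (n : nat) : set R := [set` `[- n.+1%:R, - n.+1%:R^-1]].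
apply: (@pvmq_bigcup0 B) => //; first by move=> n; exact: measurable_itv.
  move=> n; have mB : measurable (B n) by exact: measurable_itv.
  have c0 : - n.+1%:R != 0 :> R by rewrite oppr_eq0 pnatr_eq0.
  have bB l : B n l -> n.+1%:R^-1 <= - l <= n.+1%:R.
    by rewrite /B /= in_itv /= lerNl => /andP[h1 h2]; rewrite h1 andbT lerNr.
  have [|g [gA ipg _]] := spectral_integral_proj P measurable_idR mB c0 _ Hf.
    move=> l /bB /band_bound[_ _]; by rewrite invrN mulrN mulNr.
  have HE := pvm_inL2 P mB Hf.
  have : 0 <= ip g (E (B n) f).
    have := A_positive ((A_resolution.2 _ _).2 gA).
    by rewrite lecE => /andP[_].
  rewrite ipg//.
  (* The sign is changed because [form_proj_diag] works with functions that are nonnegative on the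
     band. *)
  pose chi := (-%R : R -> R) \_ (B n).
  have mchi : measurable_fun setT chi by apply: measurable_patch.
  have chiB l : 0 <= chi l <= n.+1%:R.
    rewrite /chi patchE; case: ifPn => [/set_mem/bB/band_bound[]//|_].
    by rewrite lexx ler0n.
  have chi0 l : B n l -> 0 <= chi l by move=> _; have /andP[] := chiB l.
  have Ichi w : (nu w).-integrable setT (EFin \o chi).
    apply: (nu_bounded_integrable mu E w measurableT (M := n.+1%:R)) => // l _.
    by have /andP[h1 h2] := chiB l; rewrite ger0_norm.
  have QN w : Q ((fun l => l) \_ (B n)) w = - Q chi w.
    rewrite -mulN1r /spectral_int -(RintegralZl _ measurableT (Ichi w));
      apply: eq_Rintegral => l _.
    by rewrite /chi !patchE; case: ifP; rewrite ?mulN1r ?opprK ?oppr0.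
  have -> : form ((fun l => l) \_ (B n)) f (E (B n) f) = - form chi f (E (B n) f).
    rewrite /polar_form (QN (fun x => f x + E (B n) f x)) (QN (fun x => f x - E (B n) f x)).
    by rewrite -opprD mulNr.
  rewrite (formC P _ Hf HE) (form_proj_diag P mchi mB chi0 Hf (Ichi f)).
  rewrite oppr_ge0 => Q0.
  have : n.+1%:R^-1 * pvmq (B n) f f <= Q (chi \_ (B n)) f.
    apply: le_pvmq_Q => //.
      rewrite (_ : chi \_ (B n) = chi); first exact: Ichi.
      apply/funext => l; rewrite /chi !patchE.
      by case: (l \in B n).
    move=> l; rewrite !patchE indicE; case: ifPn => [lB|lB]; last by rewrite mulr0.
    by rewrite /chi patchE lB mulr1; have /andP[] := bB _ (set_mem lB).
  move=> /le_trans/(_ Q0) h; apply/eqP; rewrite eq_le (pvmq_ge0 P)// andbT.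
  by rewrite -(pmulr_rle0 _ (_ : 0 < n.+1%:R^-1 :> R))// invr_gt0.
move=> l /=; rewrite in_itv /= => l0.
have [n /andP[h1 h2]] : exists n : nat, n.+1%:R^-1 <= - l <= n.+1%:R.
  by apply: pos_band; rewrite oppr_gt0.
by exists n => //; rewrite /B /= in_itv /= lerNl h2 lerNr.
Qed.

(** Testing A h = 0 against E(B) h for a band B gives \int_B l dnu_h = 0. *)
Lemma kerA_pvmq_pos h : kerA A h -> pvmq `]0, +oo[ h h = 0.
Proof.
move=> /A_resolution.2 [Dh _ hA]; have [Hh _] := Dh.
have Ih := spectral_dom_integrable P measurable_idR Dh.
pose B (n : nat) : set R := [set` `[n.+1%:R^-1, n.+1%:R]].
apply: (@pvmq_bigcup0 B) => //; first by move=> n; exact: measurable_itv.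
  move=> n; have mB : measurable (B n) by exact: measurable_itv.
  have c0 : n.+1%:R != 0 :> R by rewrite pnatr_eq0.
  have bB l : B n l -> n.+1%:R^-1 <= l <= n.+1%:R by rewrite /B /= in_itv.
  have [|g [[DB _ _] _ _]] := spectral_integral_proj P measurable_idR mB c0 _ Hh.
    by move=> l /bB /band_bound[].
  have HE := pvm_inL2 P mB Hh.
  have := hA _ DB; rewrite innerE ip0l (spectral_formE P _ Hh HE) => -[+ _].
  rewrite (formC P _ Hh HE).
  have bB' l : B n l -> 0 <= l by move=> /bB /band_bound[].
  rewrite (form_proj_diag P measurable_idR mB bB' Hh Ih).
  move=> Q0; have : n.+1%:R^-1 * pvmq (B n) h h <= Q ((fun l => l) \_ (B n)) h.
    apply: le_pvmq_Q => //.
      apply: (nu_bounded_integrable mu E h measurableT (M := n.+1%:R)).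
        exact: measurable_patch.
      move=> l _; rewrite patchE; case: ifPn => [/set_mem/bB/band_bound[l0 /andP[_ l1]
        _]|_].
        by rewrite ger0_norm.
      by rewrite normr0 ler0n.
    move=> l; rewrite !patchE indicE; case: ifPn => [lB|lB]; last by rewrite mulr0.
    by rewrite mulr1; have /andP[] := bB _ (set_mem lB).
  rewrite -Q0 => h0; apply/eqP; rewrite eq_le (pvmq_ge0 P)// andbT.
  by rewrite -(pmulr_rle0 _ (_ : 0 < n.+1%:R^-1 :> R))// invr_gt0.
move=> l /=; rewrite in_itv /= andbT => /pos_band[n ?].
by exists n => //; rewrite /B /= in_itv.
Qed.

Lemma ip_null u w : inL2 mu u -> inL2 mu w -> ip w w = 0 -> ip u w = 0.
Proof.
move=> Hu Hw w0; have := ip_cauchy_schwarz Hu Hw; rewrite w0 mulr0 => h.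
by apply/eqP; rewrite -sqrf_eq0 eq_le h sqr_ge0.
Qed.

Lemma inner_null u w : inL2 mu u -> inL2 mu w -> ip w w = 0 -> inner mu u w = 0.
Proof.
move=> Hu Hw w0; rewrite innerE (ip_null Hu Hw w0) (ip_null Hu _ _)//; first exact: inL2Z.
by rewrite ip_i.
Qed.

(** The function l is 0 on {0}, so A E({0}) u is orthogonal to itself, hence null; the graph of A is
    stable under a.e. equality. *)
Lemma kerA_proj0 u : inL2 mu u -> kerA A (E [set 0] u).
Proof.
move=> Hu; have m0 : measurable [set 0 : R] by exact: measurable_set1.
have [|g [gA ipg _]] := spectral_integral_proj P measurable_idR m0 (oner_neq0 R) _ Hu.
  by move=> l /= ->; rewrite mul0r lexx ler01.
have {}gA := (A_resolution.2 _ _).2 gA.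
have [Alin _ _] := A_selfadjoint.
have [HE Hg] := operator_inL2 Alin gA.
apply: (operator_ae Alin gA HE (inL2_0 mu)); first exact: nearW.
apply: ip_eq0_ae => //; rewrite ipg// /polar_form.
have Q0 w : Q ((fun l => l) \_ [set 0]) w = 0.
  rewrite /spectral_int /Rintegral integral0_eq// => l _.
  by rewrite patchE; case: ifPn => // /set_mem /= ->.
by rewrite (Q0 (fun x => u x + g x)) (Q0 (fun x => u x - g x)) subrr mul0r.
Qed.

Lemma V_space_i v : V_space mu A v -> V_space mu A (fun x => Complex 0 1 * v x).
Proof.
move=> [Hv v0]; have Hi := inL2Z (Complex 0 1) Hv; split => // h Kh.
have Hh : inL2 mu h.
  by have [Alin _ _] := A_selfadjoint; have [] := operator_inL2 Alin Kh.
have := v0 h Kh; rewrite !innerE => -[h1 h2].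
by rewrite ip_i h1 ip_il// h2 oppr0.
Qed.

(** v is orthogonal to E({0}) v, which lies in the kernel. *)
Lemma V_space_pvmq0 v : V_space mu A v -> pvmq [set 0] v v = 0.
Proof.
move=> [Hv v0]; have := v0 _ (kerA_proj0 Hv).
by rewrite innerE => -[+ _]; rewrite /pvm_form ipC.
Qed.

Lemma pvmq_null B u v : measurable B -> inL2 mu u -> inL2 mu v -> pvmq B u u = 0 ->
  pvmq B v u = 0.
Proof.
move=> mB Hu Hv B0; rewrite /pvm_form (pvm_ip P mB Hv Hu); apply: ip_null => //.
  exact: (pvm_inL2 P).
by rewrite (pvmqI P).
Qed.

(** Additivity over the three pieces of the line is available for the diagonal measures only, so it
    is carried to u, v by polarization. *)
Lemma pvmq_line u v : inL2 mu u -> inL2 mu v ->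
  ip u v = pvmq [set 0] u v + pvmq `]0, +oo[ u v.
Proof.
move=> Hu Hv; have Hp := inL2D Hu Hv; have Hm := inL2B Hu Hv.
have N : pvmq `]-oo, 0[ u v = 0 by apply: pvmq_null => //; exact: pvmq_neg.
have m0 : measurable [set 0 : R] by exact: measurable_set1.
have S w : inL2 mu w ->
    pvmq setT w w = pvmq [set 0] w w + pvmq `]0, +oo[ w w + pvmq `]-oo, 0[ w w.
  move=> Hw.
  have mI (i : interval R) : measurable [set` i] by exact: measurable_itv.
  have : nu w setT = (nu w [set 0%R] + nu w [set` `]0%R, +oo[%R] + nu w [set` `]-oo,
    0%R[%R])%E.
    rewrite -measureU//; last first.
      by apply/seteqP; split => // l [/= ->]; rewrite in_itv /= ltxx.
    rewrite -measureU//; last 2 first.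
    - exact: measurableU.
    - apply/seteqP; split => // l [/= [->|]]; rewrite !in_itv /= ?ltxx// andbT.
      by move=> /lt_trans h /h; rewrite ltxx.
    congr (nu w _); apply/seteqP; split => // l _ /=.
    by rewrite !in_itv /= andbT; case: (ltgtP l 0) => h; [right|left; right|left; left].
  have e B (mB : measurable B) := nuE P Hw mB.
  by rewrite !e// -!EFinD => -[].
suff -> : ip u v = pvmq [set 0] u v + pvmq `]0, +oo[ u v + pvmq `]-oo, 0[ u v by
  rewrite N addr0.
rewrite -(pvmqT P Hu Hv).
rewrite (pvmq_polarization P measurableT Hu Hv) (pvmq_polarization P m0 Hu Hv).
rewrite (pvmq_polarization P (measurable_itv `]0, +oo[) Hu Hv).
rewrite (pvmq_polarization P (measurable_itv `]-oo, 0[) Hu Hv).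
by rewrite (S _ Hp) (S _ Hm); ring.
Qed.

(** Kernel vectors have no mass on ]0, +oo[, so E(]0, +oo[) u is orthogonal to them; vectors of V
    have no mass at 0, and nothing has mass below 0, so u - E(]0, +oo[) u is orthogonal to V. *)
Lemma orthogonal_projection_pos u : inL2 mu u ->
  orthogonal_projection mu (V_space mu A) u (E `]0, +oo[ u).
Proof.
move=> Hu; have mp : measurable (`]0, +oo[ : set R) by exact: measurable_itv.
have m0 : measurable [set 0 : R] by exact: measurable_set1.
have HE := pvm_inL2 P mp Hu.
have [Alin _ _] := A_selfadjoint.
split => //.
  split => // h Kh; have [Hh _] := operator_inL2 Alin Kh.
  rewrite (pvm_sym P mp Hu Hh); apply: inner_null => //; first exact: (pvm_inL2 P).
  by rewrite (pvmqI P)//; exact: kerA_pvmq_pos.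
move=> v Vv.
have H w : V_space mu A w -> ip (fun x => u x - E `]0, +oo[ u x) w = 0.
  move=> Vw; have [Hw w0] := Vw; rewrite ipBl// (pvmq_line Hu Hw) addrK.
  by rewrite (pvmq_null m0 Hw Hu)// V_space_pvmq0.
rewrite innerE (H _ Vv) (H _ (V_space_i Vv)).
by [].
Qed.

Lemma V_space_proj f u : V_space mu A f -> inL2 mu u -> ip f u = pvmq `]0, +oo[ f u.
Proof.
move=> Vf Hu; have [Hf _] := Vf; have m0 : measurable [set 0 : R] by exact: measurable_set1.
by rewrite (pvmq_line Hf Hu) (pvmqC P m0 Hf Hu) (pvmq_null m0 Hf Hu) ?add0r// V_space_pvmq0.
Qed.

End positive_resolution.

(** * Energy and Cauchy-Schwarz in the functional calculus *)

Section energy.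
Context {R : realType} {d : measure_display} {X : measurableType d}.
Variable mu : {measure set X -> \bar R}.
Variable E : set R -> (X -> R[i]) -> X -> R[i].
Hypothesis P : projection_valued_measure mu E.
Local Notation ip := (real_inner mu).
Local Notation pvmq := (pvm_form mu E).
Local Notation nu := (spectral_measure mu E).
Local Notation Q := (spectral_int mu E).
Local Notation form := (polar_form mu E).
Implicit Types (f g h u v : X -> R[i]) (B C : set R) (phi psi : R -> R).

Lemma measurable_sqrt : measurable_fun setT (@Num.sqrt R).
Proof. by apply: continuous_measurable_fun; exact: sqrt_continuous. Qed.

Lemma spectral_dom_proj phi B f : measurable_fun setT phi -> measurable B ->
  spectral_dom mu E phi f -> spectral_dom mu E phi (E B f).
Proof.
move=> mphi mB [Hf I]; have HE := pvm_inL2 P mB Hf; split; first exact: HE.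
apply: le_lt_trans I; rewrite (integral_nu _ _ P HE) (integral_nu _ _ P Hf).
apply: ge0_le_measure_integral => //; last 2 first.
- by move=> l; rewrite lee_fin sqr_ge0.
- by apply/measurable_EFinP; exact: measurable_funX.
move=> C mC; rewrite [leLHS](nu_proj P mB mC Hf).
by apply: le_measure; rewrite ?inE//; exact: measurableI.
Qed.

Lemma spectral_dom_sqr_integrable phi f : measurable_fun setT phi ->
  spectral_dom mu E phi f -> (nu f).-integrable setT (EFin \o (fun l => phi l ^+ 2)).
Proof.
move=> mphi [Hf I]; apply/integrableP; split.
  by apply/measurable_EFinP; exact: measurable_funX.
move: I; rewrite integral_nu//; apply: le_lt_trans.
by under eq_integral do rewrite gee0_abs ?lee_fin ?sqr_ge0//.
Qed.

(* Testing g = phi(A) f against the vectors s(A) f, for step functions s <= phi,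
   avoids any truncation of phi. *)
Lemma Q_sqr_le_ip phi f g : measurable_fun setT phi -> (forall l, 0 <= phi l) ->
  spectral_integral mu E phi f g -> Q (fun l => phi l ^+ 2) f <= ip g g.
Proof.
move=> mphi phi0 [Df Hg gE]; have [Hf _] := Df.
have Iphi := spectral_dom_integrable P mphi Df.
have Iphi2 := spectral_dom_sqr_integrable mphi Df.
have ipgE B : measurable B -> ip g (E B f) = Q (phi \_ B) f.
  move=> mB; have HE := pvm_inL2 P mB Hf.
  have := gE _ (spectral_dom_proj mphi mB Df).
  rewrite innerE (spectral_formE P phi Hf HE) => -[-> _].
  by rewrite (formC P phi Hf HE) (form_proj_diag P mphi mB (fun l _ => phi0 l) Hf Iphi).
have Istep s : measurable_steps s -> (nu f).-integrable setT (EFin \o (fun l =>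
  step_fun s l * phi l)).
  move=> ws; have [M sM] := step_bounded s.
  apply: (le_integrable measurableT _ _ (integrableZl measurableT M Iphi)).
    by apply/measurable_EFinP; apply: measurable_funM => //; exact: measurable_step.
  move=> l _ /=; rewrite lee_fin !normrM ler_wpM2r//.
  exact: le_trans (sM l) (ler_norm _).
have ipgS s : measurable_steps s -> ip g (step_operator E s f) = Q (fun l => step_fun s
  l * phi l) f.
  elim: s => [_|p s IH /= [mp ws]].
    rewrite ipC ip0l /spectral_int /Rintegral integral0_eq// => l _.
    by rewrite /step_fun big_nil mul0r.
  have HE := pvm_inL2 P mp Hf; have HS := inL2_Sop P ws Hf.
  rewrite ipC ip_linl// [ip (E _ f) g]ipC [ip _ g]ipC (ipgE _ mp) (IH ws).
  have IB : (nu f).-integrable setT (EFin \o (phi \_ p.2)).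
    rewrite -restrict_EFin; apply: (iffLR (integrable_mkcond _ mp)).
    exact: integrableS Iphi.
  have IB' := integrableZl measurableT p.1 IB.
  rewrite /spectral_int -(RintegralZl _ measurableT IB) -(RintegralD measurableT IB'
    (Istep _ ws)).
  apply: eq_Rintegral => l _; rewrite /step_fun big_cons mulrDl indicE patchE.
  by case: (l \in p.2); rewrite ?mulr1 ?mulr0 ?mul0r.
have [s [ws s_le _ s_cvg]] := step_approx mphi phi0.
have le_n n : Q (fun l => step_fun (s n) l ^+ 2) f <= ip g g.
  have HS := inL2_Sop P (ws n) Hf; set h := step_operator E (s n) f in HS.
  have m2 : measurable_fun setT (fun l => step_fun (s n) l ^+ 2).
    by apply: measurable_funX; exact: measurable_step.
  have I2 : (nu f).-integrable setT (EFin \o (fun l => step_fun (s n) l ^+ 2)).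
    apply: (le_integrable measurableT _ _ Iphi2); first exact/measurable_EFinP.
    move=> l _ /=; rewrite lee_fin !ger0_norm ?sqr_ge0//.
    by have /andP[h1 h2] := s_le n l; rewrite lerXn2r// nnegrE.
  have hh : Q (fun l => step_fun (s n) l ^+ 2) f = ip h h.
    rewrite /h (ip_SopS P (ws n) (ws n) Hf Hf) -(Q_step P (wf_prodl (ws n) (ws n)) Hf).
    by apply: eq_Rintegral => l _; rewrite step_prodl expr2.
  have hg : ip h h <= ip g h.
    rewrite -hh /h (ipgS _ (ws n)); apply: le_Q I2 (Istep _ (ws n)) _ => l.
    by have /andP[h1 h2] := s_le n l; rewrite expr2 ler_wpM2l.
  (* From |h|^2 <= <g, h>, Cauchy-Schwarz gives |h|^4 <= |g|^2 |h|^2, and |h|^2 is divided out. *)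
  rewrite hh; have := ip_ge0 mu h; rewrite le_eqVlt => /predU1P[<-|h0]; first exact: ip_ge0.
  rewrite -(ler_pM2r h0); apply: le_trans (ip_cauchy_schwarz Hg HS).
  by rewrite -expr2 lerXn2r// nnegrE ?ip_ge0// (le_trans _ hg)// ip_ge0.
have := @Q_dominated_cvg _ _ _ mu E (fun n l => step_fun (s n) l ^+ 2) (fun l => phi l ^+ 2)
  (fun l => phi l ^+ 2) f.
move=> /(_ _ _ _ Iphi2) H.
apply: (ler_cvg_to (H _ _ _ _) (cvg_cst _)).
- by move=> n; apply: measurable_funX; exact: measurable_step.
- exact: measurable_funX.
- by move=> l; exact: cvgM.
- move=> n l; have /andP[h1 h2] := s_le n l.
  by rewrite ger0_norm ?sqr_ge0// lerXn2r// nnegrE.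
- exact: nearW.
Qed.

(** For step functions the form is <s(A) f, s'(A) u>, and the ordinary inequality applies. The bound
    alpha beta <= 1 supplies a constant dominating function for the limit, integrable for the finite
    spectral measures of f + u and f - u. *)
Lemma form_cauchy_schwarz (alpha beta : R -> R) f u :
  measurable_fun setT alpha -> measurable_fun setT beta ->
  (forall l, 0 <= alpha l) -> (forall l, 0 <= beta l) ->
  (forall l, alpha l * beta l <= 1) -> inL2 mu f -> inL2 mu u ->
  (nu f).-integrable setT (EFin \o (fun l => alpha l ^+ 2)) ->
  (nu u).-integrable setT (EFin \o (fun l => beta l ^+ 2)) ->
  form (fun l => alpha l * beta l) f u ^+ 2 <=
    Q (fun l => alpha l ^+ 2) f * Q (fun l => beta l ^+ 2) u.
Proof.
move=> ma mb a0 b0 ab1 Hf Hu Ia Ib.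
have [s [ws s_le _ s_cvg]] := step_approx ma a0.
have [s' [ws' s'_le _ s'_cvg]] := step_approx mb b0.
have Q_le g t (phi : R -> R) : inL2 mu g -> measurable_steps t ->
    (nu g).-integrable setT (EFin \o (fun l => phi l ^+ 2)) ->
    (forall l, 0 <= step_fun t l <= phi l) ->
    ip (step_operator E t g) (step_operator E t g) <= Q (fun l => phi l ^+ 2) g.
  move=> Hg wt I le_t.
  rewrite (ip_SopS P wt wt Hg Hg) -(Q_step P (wf_prodl wt wt) Hg).
  apply: le_Q => //; first by apply: step_integrable; exact: wf_prodl.
  move=> l; rewrite step_prodl -expr2; have /andP[h1 h2] := le_t l.
  by rewrite lerXn2r// nnegrE (le_trans h1).
have H : form (fun l => step_fun (s n) l * step_fun (s' n) l) f u @[n --> \oo] -->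
    form (fun l => alpha l * beta l) f u.
  apply: (form_dominated_cvg _ _ _ (integrable_cst1 mu E _) (integrable_cst1 mu E _)).
  - by move=> n; apply: measurable_funM; exact: measurable_step.
  - exact: measurable_funM.
  - by move=> l; exact: cvgM.
  - move=> n l; have /andP[h1 h2] := s_le n l; have /andP[h3 h4] := s'_le n l.
    rewrite ger0_norm ?mulr_ge0//; apply: le_trans (ab1 l).
    by rewrite ler_pM.
have H2 : form (fun l => step_fun (s n) l * step_fun (s' n) l) f u ^+ 2 @[n --> \oo] -->
    form (fun l => alpha l * beta l) f u ^+ 2 by exact: (cvgM H H).
apply: (ler_cvg_to H2 (cvg_cst _)); apply: nearW => n /=.
rewrite (_ : (fun l => _) = step_fun (mul_steps (s n) (s' n))); last first.
  by apply/funext => l; rewrite step_prodl.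
rewrite (form_step P (wf_prodl (ws n) (ws' n)) Hf Hu) -(ip_SopS P (ws n) (ws' n) Hf Hu).
apply: le_trans (ip_cauchy_schwarz (inL2_Sop P (ws n) Hf) (inL2_Sop P (ws' n) Hu)) _.
by apply: ler_pM; rewrite ?ip_ge0// Q_le.
Qed.

End energy.

(* No measurability: the integral of a nonnegative function is the supremum of
   the integrals of the simple functions below it. *)
Lemma ge0_le_integral_nonmeasurable d (T : measurableType d) (R : realType)
    (m : {measure set T -> \bar R}) (D : set T) (f g : T -> \bar R) :
  (forall x, D x -> (0 <= f x)%E) -> (forall x, D x -> (f x <= g x)%E) ->
  (\int[m]_(x in D) f x <= \int[m]_(x in D) g x)%E.
Proof.
move=> f0 fg; have g0 x : D x -> (0 <= g x)%E by move=> Dx;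
  exact: le_trans (f0 x Dx) (fg x Dx).
rewrite !ge0_integralE//; apply: ereal_sup_le => _ [h /= hf <-]; exists h => //= x.
apply: le_trans (hf x) _; rewrite !patchE; case: ifPn => // /set_mem; exact: fg.
Qed.

Lemma integral_expR_tail (R : realType) (a l : R) : 0 < l ->
  (\int[lebesgue_measure]_(s in `]a, +oo[) (expR (- s * l))%:E = (expR (- a * l) / l)%:E)%E.
Proof.
move=> l0.
have cexp : continuous (fun s : R => expR (- s * l)).
  move=> s; apply: continuous_comp; last exact: continuous_expR.
  by apply: continuousM; [exact: opp_continuous|exact: cst_continuous].
rewrite integral_itv_obnd_cbnd; last first.
  apply/measurable_EFinP; apply: measurable_funTS; exact: continuous_measurable_fun.
have cF : continuous (fun s : R => - (expR (- s * l) / l)).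
  by move=> s; apply: cvgN; apply: cvgM; [exact: cexp|exact: cvg_cst].
have dF (s : R) : is_derive s 1 (fun s : R => - (expR (- s * l) / l)) (expR (- s * l)).
  apply: is_derive_eq; rewrite /GRing.scale /=.
  by field; rewrite gt_eqF.
rewrite (@ge0_continuous_FTC2y _ _ (fun s => - (expR (- s * l) / l)) _ 0)//.
- by rewrite EFinN oppeK add0e.
- exact: continuous_subspaceT.
- rewrite -oppr0 -(mul0r l^-1); apply: cvgN; apply: cvgM; last exact: cvg_cst.
  rewrite (_ : (fun x => expR (- x * l)) =
               (fun z => expR (- z)) \o (fun z => l * z)); last first.
    by apply: eq_fun => x /=; rewrite mulNr mulrC.
  apply: (@cvg_comp _ _ _ _ _ _ (pinfty_nbhs R)); last exact: cvgr_expR.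
  exact: gt0_cvgMry.
- by apply/cvg_at_right_filter; exact: cF.
- by move=> s _; rewrite derive1E; exact: derive_val.
Qed.

(** * The heat semigroup and the functions L and M *)

Section heat_kernel.
Context {R : realType} {d : measure_display} {X : measurableType d}.
Variable mu : {measure set X -> \bar R}.
Variables (A : graph R X) (E : set R -> (X -> R[i]) -> X -> R[i]).
Hypothesis A_selfadjoint : selfadjoint mu A.
Hypothesis A_positive : positive_operator mu A.
Hypothesis A_resolution : spectral_resolution mu A E.
Local Notation ip := (real_inner mu).
Local Notation pvmq := (pvm_form mu E).
Local Notation nu := (spectral_measure mu E).
Local Notation Q := (spectral_int mu E).
Local Notation form := (polar_form mu E).
Implicit Types (f g h u v : X -> R[i]) (B C : set R) (phi psi : R -> R).

Let P : projection_valued_measure mu E := A_resolution.1.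

(** The multiplier of e^{-tA} Pi_V: the cut-off to l > 0 is the projection, and it also keeps the
    values in [0, 1] for t >= 0. *)
Definition heat_mult (t : R) : R -> R := (fun l => expR (- t * l)) \_ `]0, +oo[.

Lemma measurable_exp_mul (t : R) : measurable_fun setT (fun l : R => expR (- t * l)).
Proof. by apply: measurableT_comp => //; exact: measurable_funM. Qed.

Lemma measurable_heatf t : measurable_fun setT (heat_mult t).
Proof. by apply: measurable_patch; [exact: measurable_itv|exact: measurable_exp_mul]. Qed.

Lemma mem_pos (l : R) : (l \in `]0, +oo[%classic) = (0 < l).
Proof. by rewrite mem_setE in_itv /= andbT. Qed.

Lemma heatfE t l : heat_mult t l = if 0 < l then expR (- t * l) else 0.
Proof. by rewrite /heat_mult patchE mem_pos. Qed.

Lemma heatf01 t l : 0 <= t -> 0 <= heat_mult t l <= 1.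
Proof.
move=> t0; rewrite heatfE; case: ifP => l0; last by rewrite lexx ler01.
by rewrite expR_ge0 -expR0 ler_expR mulNr oppr_le0 mulr_ge0// ltW.
Qed.

Lemma heatf_integrable t u : 0 <= t -> (nu u).-integrable setT (EFin \o heat_mult t).
Proof.
move=> t0; apply: (nu_bounded_integrable mu E u measurableT (measurable_heatf t) (M :=
  1)) => l _.
by have /andP[h1 h2] := heatf01 l t0; rewrite ger0_norm.
Qed.

Lemma heat_exists t u : 0 <= t -> inL2 mu u -> exists g,
  [/\ inL2 mu g, heat mu A t (E `]0, +oo[ u) g,
    forall v, inL2 mu v -> ip g v = form (heat_mult t) u v &
    ip g g <= Q (fun l => heat_mult t l ^+ 2) u].
Proof.
move=> t0 Hu.
have [|g [gE ipg ipgg]] := spectral_integral_proj P (measurable_exp_mul t)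
  (measurable_itv `]0, +oo[) (oner_neq0 R) _ Hu.
  move=> l lpos; rewrite divr1.
  by have := heatf01 l t0; rewrite /heat_mult patchE mem_set.
exists g; split => //; first by case: gE.
by exists E.
Qed.

Lemma measurable_normc u : inL2 mu u -> measurable_fun setT (fun x => Normc.normc (u x)).
Proof.
move=> /inL2P[[mr mi] _].
rewrite (_ : (fun x => _) = (@Num.sqrt R) \o (fun x => re (u x) ^+ 2 + im (u x) ^+ 2)).
  apply: measurableT_comp; first exact: measurable_sqrt.
  by apply: measurable_funD; exact: measurable_funX.
by apply/funext => x /=; case: (u x).
Qed.

Lemma cLnorm_oo_ae g : {ae mu, forall x, ((Normc.normc (g x))%:E <= cLnorm mu +oo g)%E}.
Proof.
rewrite /cLnorm unlock; case: ifPn => [_|].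
  have := ess_sup_ge mu (abse \o (fun x => (Normc.normc (g x))%:E)).
  by apply: filterS => x; rewrite /= ger0_norm ?normc_ge0.
(* In this branch the whole space is null, so every property holds a.e. *)
rewrite -leNgt => mu0; exists setT; split => //.
by apply/eqP; rewrite eq_le mu0 measure_ge0.
Qed.

(** Lagrange's identity: the squares differ by the square of the determinant of a and b. *)
Lemma ip_le_normc (a b : R[i]) : re a * re b + im a * im b <= Normc.normc a * Normc.normc b.
Proof.
apply: le_trans (ler_norm _) _; rewrite -[leRHS]ger0_norm ?mulr_ge0 ?normc_ge0//.
rewrite -ler_sqr ?nnegrE// !real_normK ?num_real// exprMn !normc_sqc /sqc.
rewrite -subr_ge0 (_ : _ - _ = (re a * im b - im a * re b) ^+ 2) ?sqr_ge0//; ring.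
Qed.

Lemma ip_le_cLnorm g u : inL2 mu g -> inL2 mu u -> (cLnorm mu 1%:E u <= 1)%E ->
  ((ip g u)%:E <= cLnorm mu +oo g)%E.
Proof.
move=> Hg Hu u1.
have [K|goo] := boolP (cLnorm mu +oo g \is a fin_num); last first.
  have : (0 <= cLnorm mu +oo g)%E by exact: Lnorm_ge0.
  by move: goo; rewrite fin_numE; case: (cLnorm _ _ _) => //= _ _; rewrite leey.
set k := fine (cLnorm mu +oo g); have k0 : 0 <= k by rewrite fine_ge0// Lnorm_ge0.
have I := ip_integrable Hg Hu.
have mu1 := measurable_normc Hu; have mg1 := measurable_normc Hg.
rewrite ipE /Rintegral fineK; last exact: (integrable_fin_num measurableT I).
apply: (@le_trans _ _ (\int[mu]_x (Normc.normc (g x) * Normc.normc (u x))%:E)%E).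
  apply: le_trans (_ : _ <= \int[mu]_x `|(re (g x) * re (u x) + im (g x) * im (u
    x))%R%:E|)%E _.
    apply: le_trans (lee_abs _) _; apply: le_abse_integral => //.
    by case/integrableP: I.
  apply: ge0_le_integral => //.
  - by apply: measurableT_comp => //; case/integrableP: I.
  - by apply/measurable_EFinP; exact: measurable_funM.
  - move=> x _; rewrite lee_fin /= ler_norml ip_le_normc andbT.
    have := ip_le_normc (- g x) (u x); rewrite normcN re_opp im_opp !mulNr -opprD.
    by rewrite lerNl.
apply: (@le_trans _ _ (\int[mu]_x (k%:E * (Normc.normc (u x))%:E))%E).
  apply: ae_ge0_le_integral => //.
  - by move=> x _; rewrite lee_fin mulr_ge0 ?normc_ge0.
  - by apply/measurable_EFinP; exact: measurable_funM.
  - by move=> x _; rewrite mule_ge0 ?lee_fin ?normc_ge0.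
  - by apply: measurable_funeM; exact/measurable_EFinP.
  - have := cLnorm_oo_ae g; apply: filterS => x + _.
    rewrite -[cLnorm _ _ _]fineK// lee_fin => gk.
    by rewrite EFinM lee_fin ler_wpM2r// normc_ge0.
have mE : measurable_fun setT (fun x => (Normc.normc (u x))%:E) by exact/measurable_EFinP.
have uE x : setT x -> (0 <= (Normc.normc (u x))%:E)%E by rewrite lee_fin normc_ge0.
rewrite ge0_integralZl//.
rewrite -[leRHS]fineK// -/k -[leRHS]mule1; apply: lee_wpmul2l; first by rewrite lee_fin.
apply: le_trans u1; rewrite /cLnorm Lnorm1; apply: ge0_le_integral => //.
- exact: measurableT_comp.
- by move=> x _ /=; rewrite lee_fin ler_norm.
Qed.

(** Here u serves both as input and as test function: <T_t Pi_V u, u> is at most |T_t Pi_V u|_oo,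
    and the vector from [heat_exists] is an admissible competitor in the supremum that defines L. *)
Lemma Q_heatf_le_L t u : 0 <= t -> inL2 mu u -> inLp mu 1%:E u ->
  (cLnorm mu 1%:E u <= 1)%E -> ((Q (heat_mult t) u)%:E <= L_fun mu A t)%E.
Proof.
move=> t0 Hu Hu1 u1; have [g [Hg gheat ipg _]] := heat_exists t0 Hu.
rewrite -(form_diag P (measurable_heatf t) _ Hu); last by move=> l;
  have /andP[] := heatf01 l t0.
rewrite -ipg//; apply: le_trans (ip_le_cLnorm Hg Hu u1) _.
apply: ereal_sup_ubound; exists u, g; split => //.
exists (E `]0, +oo[ u) => //.
exact: (orthogonal_projection_pos A_selfadjoint A_positive A_resolution Hu).
Qed.

(** The multiplier of A^{-1/2} e^{-tA} Pi_V, the partner of A^{1/2} in Cauchy-Schwarz. Its square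
    e^{-2tl} / l is the integral of e^{-sl} over s > 2t, which is why M is evaluated at 2t. *)
Definition sqrt_res_mult (t : R) : R -> R := (fun l => expR (- t * l) * l `^ (- 2^-1))
  \_ `]0, +oo[.

Lemma measurable_resf t : measurable_fun setT (sqrt_res_mult t).
Proof.
apply: measurable_patch; first exact: measurable_itv.
by apply: measurable_funM; [exact: measurable_exp_mul|exact: measurable_powR].
Qed.

Lemma resfE t l : sqrt_res_mult t l = if 0 < l then expR (- t * l) * l `^ (- 2^-1) else 0.
Proof. by rewrite /sqrt_res_mult patchE mem_pos. Qed.

Lemma resf_ge0 t l : 0 <= sqrt_res_mult t l.
Proof. by rewrite resfE; case: ifP => // _; rewrite mulr_ge0 ?expR_ge0 ?powR_ge0. Qed.

Lemma sqrt_resf t l : Num.sqrt l * sqrt_res_mult t l = heat_mult t l.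
Proof.
rewrite resfE heatfE; case: ifPn => l0; last by rewrite mulr0.
rewrite -powR12_sqrt ?ltW// mulrCA -powRD; last by rewrite (gt_eqF l0) implybT.
by rewrite subrr powRr0 mulr1.
Qed.

Lemma sqr_resf t l : 0 < l -> sqrt_res_mult t l ^+ 2 = expR (- (2 * t) * l) / l.
Proof.
move=> l0; have h : (l `^ (- 2^-1)) ^+ 2 = l^-1.
  rewrite -powR_mulrn ?powR_ge0// -powRrM (_ : - 2^-1 * 2%:R = -1);
    first by rewrite powR_inv1 ?ltW.
  by rewrite mulNr mulVf.
rewrite resfE l0 exprMn h -expRM_natl; congr (expR _ / _); ring.
Qed.

(** Tonelli exchanges s with the spectral variable, the spectral measure of u being finite; then
    [Q_heatf_le_L] bounds the inner integral for each s. The indicators in [F] put both domains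
    inside the integrand. *)
Lemma integral_resf_le_M t u : 0 < t -> inL2 mu u -> inLp mu 1%:E u ->
  (cLnorm mu 1%:E u <= 1)%E ->
  (\int[nu u]_l (sqrt_res_mult t l ^+ 2)%:E <= M_fun mu A (2 * t))%E.
Proof.
move=> t0 Hu Hu1 u1.
pose D : set R := `]2 * t, +oo[%classic.
pose F (z : R * R) : \bar R := (\1_(`]0, +oo[%classic : set R) z.1 * \1_D z.2 * expR (-
  z.2 * z.1))%:E.
have F0 z : (0 <= F z)%E by rewrite lee_fin !mulr_ge0// expR_ge0.
have mF : measurable_fun setT F.
  apply/measurable_EFinP; apply: measurable_funM.
    apply: measurable_funM.
      by apply: measurableT_comp => //; apply: measurable_indic; exact: measurable_itv.
    by apply: measurableT_comp => //; apply: measurable_indic; exact: measurable_itv.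
  apply: measurableT_comp => //; apply: measurable_funM => //.
  exact: measurableT_comp.
have -> : (\int[nu u]_l (sqrt_res_mult t l ^+ 2)%:E = \int[nu u]_l
  \int[lebesgue_measure]_s F (l, s))%E.
  apply: eq_integral => l _; case: (ltP 0 l) => l0; last first.
    rewrite resfE ltNge l0 /= expr0n /= integral0_eq// => s _.
    by rewrite /F /= indicE mem_pos ltNge l0 /= !mul0r.
  rewrite sqr_resf// -integral_expR_tail//.
  rewrite [LHS]integral_mkcond; apply: eq_integral => s _.
  by rewrite /F /= patchE !indicE mem_pos l0 mul1r; case: ifP; rewrite ?mul1r ?mul0r.
rewrite (@fubini_tonelli _ _ _ _ R (nu u) (@lebesgue_measure R) F mF F0).
have -> : (\int[lebesgue_measure]_s \int[nu u]_l F (l, s) =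
    \int[lebesgue_measure]_(s in D) (Q (heat_mult s) u)%:E)%E.
  rewrite [RHS]integral_mkcond; apply: eq_integral => s _.
  rewrite patchE; case: ifPn => sD; last first.
    by rewrite integral0_eq// => l _; rewrite /F /= [\1_D s]indicE (negbTE sD) mulr0 mul0r.
  have s0 : 0 <= s.
    move: (set_mem sD); rewrite /D /= in_itv /= andbT => /ltW; apply: le_trans.
    by rewrite mulr_ge0// ltW.
  rewrite /spectral_int /Rintegral fineK; last first.
    exact: (integrable_fin_num measurableT (heatf_integrable u s0)).
  apply: eq_integral => l _; rewrite /F /= [\1_D s]indicE sD mulr1 indicE mem_pos heatfE.
  by case: ifP; rewrite ?mul1r ?mul0r.
have D0 s : D s -> 0 <= s.
  by rewrite /D /= in_itv /= andbT => /ltW; apply: le_trans; rewrite mulr_ge0// ltW.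
(* [L_fun] is a supremum over an uncountable family, with no measurability at hand. *)
apply: ge0_le_integral_nonmeasurable.
- move=> s Ds; rewrite lee_fin; apply: Rintegral_ge0 => l _.
  by have /andP[] := heatf01 l (D0 s Ds).
- by move=> s Ds; apply: Q_heatf_le_L => //; exact: D0.
Qed.

End heat_kernel.

(** * Pointwise bounds from duality with L^1 *)

Section linf.
Context {R : realType} {d : measure_display} {X : measurableType d}.
Variable mu : {measure set X -> \bar R}.
Local Notation ip := (real_inner mu).

(* Each superlevel set of an L^2 function has finite measure, so G restricted to it
   is an admissible test function even when mu is not sigma-finite. *)
Lemma ae_normc_lt (G : X -> R[i]) (K c : R) : inL2 mu G -> 0 <= K -> K < c ->
  (forall u, inL2 mu u -> inLp mu 1%:E u -> (cLnorm mu 1%:E u <= 1)%E -> ip G u <= K) ->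
  {ae mu, forall x, Normc.normc (G x) < c}.
Proof.
move=> HG K0 Kc HK; have c0 : 0 < c by apply: le_lt_trans Kc.
pose D := [set x | c <= Normc.normc (G x)].
have mG := measurable_normc HG.
have mD : measurable D.
  rewrite /D -[X in measurable X]setTI.
  have := measurable_fun_ler (measurable_cst (c : R)) mG.
  by move=> /(_ measurableT [set true] I).
have m1 : measurable_fun setT (\1_D : X -> R) by exact: measurable_indic.
pose w x : R := \1_D x * Normc.normc (G x).
have mw : measurable_fun setT w by exact: measurable_funM.
have w0 x : 0 <= w x by rewrite mulr_ge0 ?normc_ge0.
have ww x : c * w x <= \1_D x * sqc (G x).
  rewrite /w indicE; case: (boolP (x \in D)) => [xD|_]; last by rewrite !mul0r mulr0.
  by rewrite !mul1r -normc_sqc expr2 ler_wpM2r ?normc_ge0//; exact: (set_mem xD).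
have /inL2P[[mr mi] IG] := HG.
have i1 x : 0 <= (\1_D x : R) <= 1 by rewrite indicE; case: (_ \in _);
  rewrite /= ?lexx ?ler01.
have Iw : mu.-integrable setT (EFin \o w).
  apply: (le_integrable measurableT _ _ (integrableZl measurableT c^-1 IG)).
    exact/measurable_EFinP.
  move=> x _ /=; rewrite lee_fin (ger0_norm (w0 x)) ger0_norm ?mulr_ge0 ?sqc_ge0
    ?invr_ge0 ?(ltW c0)//.
  rewrite mulrC ler_pdivlMr// mulrC; apply: le_trans (ww x) _.
  by rewrite ler_piMl ?sqc_ge0//; have /andP[] := i1 x.
pose I : R := \int[mu]_x w x.
have IE : (\int[mu]_x (w x)%:E = I%:E)%E by rewrite /I /Rintegral fineK//;
  exact: (integrable_fin_num measurableT Iw).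
have I_ge0 : 0 <= I by exact: Rintegral_ge0.
move: I_ge0; rewrite le_eqVlt => /predU1P[I0|I0].
  (* If w has integral 0 it vanishes a.e., whereas w >= c > 0 on [D]. *)
  have : (\int[mu]_x `|(EFin \o w) x| = 0)%E.
    by under eq_integral do rewrite /= ger0_norm//; rewrite IE -I0.
  move/(ae_eq_integral_abs mu measurableT (measurable_int _ Iw));
    apply: filterS => x /(_ Logic.I) /= [].
  rewrite /w indicE; case: (boolP (x \in D)) => [xD|]; last first.
    by move=> + _; rewrite notin_setE /D /= => /negP; rewrite -ltNge.
  by rewrite mul1r => w00; move: (set_mem xD); rewrite /D /= w00 leNgt c0.
(* [I] is the integral of |G| over [D], so u has L^1 norm 1; since |G| >= c on [D], <G, u> >= c > K,
   against the hypothesis. *)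
pose u x := Complex (\1_D x / I) 0 * G x.
have reu x : re (u x) = \1_D x / I * re (G x) by rewrite /u re_mul /= mul0r subr0.
have imu x : im (u x) = \1_D x / I * im (G x) by rewrite /u im_mul /= mul0r addr0.
have m1I : measurable_fun setT (fun x => \1_D x / I) by exact: measurable_funM.
have cmu : cmeasurable u.
  split.
    by under eq_fun do rewrite reu; exact: measurable_funM.
  by under eq_fun do rewrite imu; exact: measurable_funM.
have normu x : Normc.normc (u x) = w x / I.
  rewrite /u Normc.normcM /= expr0n /= addr0 sqrtr_sqr ger0_norm; last first.
    by rewrite divr_ge0// ltW.
  by rewrite /w mulrAC.
have sqcu x : sqc (u x) = (\1_D x / I) ^+ 2 * sqc (G x) by rewrite /sqc reu imu; ring.
have Hu : inL2 mu u.
  apply/inL2P; split => //.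
  apply: (le_integrable measurableT _ _ (integrableZl measurableT (I^-1 ^+ 2) IG)).
    apply/measurable_EFinP; under eq_fun do rewrite sqcu.
    apply: measurable_funM; first exact: measurable_funX.
    by apply: measurable_funD; exact: measurable_funX.
  move=> x _; rewrite [X in (`|X| <= _)%E]/= sqcu /= lee_fin.
  have S a : `|a ^+ 2 * sqc (G x)| = a ^+ 2 * sqc (G x) by rewrite ger0_norm//
    mulr_ge0 ?sqc_ge0 ?sqr_ge0.
  rewrite !S.
  rewrite ler_wpM2r ?sqc_ge0// lerXn2r ?nnegrE ?divr_ge0 ?invr_ge0 ?(ltW I0)//.
  by rewrite ler_piMl ?invr_ge0 ?(ltW I0)//; have /andP[] := i1 x.
have u1 : cLnorm mu 1%:E u = 1%:E.
  rewrite /cLnorm Lnorm1.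
  transitivity (\int[mu]_x (I^-1%:E * (w x)%:E))%E.
    apply: eq_integral => x _ /=; rewrite normu ger0_norm ?divr_ge0// ?(ltW I0)//.
    by rewrite mulrC EFinM.
  by rewrite (integralZl measurableT Iw) IE -EFinM mulVf// gt_eqF.
have := HK u Hu; rewrite u1 => /(_ _ (lexx _)) H.
have : c <= ip G u.
  rewrite ipE.
  have -> : c = \int[mu]_x ((c / I) * w x).
    by rewrite (RintegralZl _ measurableT Iw) divfK// gt_eqF.
  apply: le_Rintegral => //.
  - have := integrableZl measurableT (c / I) Iw; exact: eq_integrable.
  - exact: ip_integrable.
  - move=> x _; rewrite reu imu.
    have -> : re (G x) * (\1_D x / I * re (G x)) + im (G x) * (\1_D x / I * im (G x)) =
      (\1_D x * sqc (G x)) / I by rewrite /sqc; field; rewrite gt_eqF.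
    by rewrite mulrAC ler_pM2r ?invr_gt0.
rewrite leNgt => /negP []; apply: le_lt_trans Kc; apply: H.
by split => //; rewrite u1 ltry.
Qed.

Lemma ae_normc_le (G : X -> R[i]) (K : R) : inL2 mu G -> 0 <= K ->
  (forall u, inL2 mu u -> inLp mu 1%:E u -> (cLnorm mu 1%:E u <= 1)%E -> ip G u <= K) ->
  {ae mu, forall x, Normc.normc (G x) <= K}.
Proof.
move=> HG K0 HK.
have H n : {ae mu, forall x, Normc.normc (G x) < K + n.+1%:R^-1}.
  by apply: (ae_normc_lt HG K0) => //; rewrite ltrDl invr_gt0.
have := ae_foralln H; apply: filterS => x Hx; rewrite leNgt; apply/negP => /ltr_add_invr[n].
by rewrite ltNge (ltW (Hx n)).
Qed.

End linf.

(** * Geometric grids *)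

Section grid.
Context {R : realType}.
Variable p : nat.

(* The geometric grid 2^-(p+1) 2^(k/(p+1)), whose ratio divides an octave in p+1 steps *)
Definition grid (k : nat) : R := 2 `^ (k%:R / p.+1%:R - p.+1%:R).

(** The dt/t^2 mass of the cell between two consecutive grid points. *)
Definition grid_weight (k : nat) : R := (grid k)^-1 - (grid k.+1)^-1.

Definition grid_ratio : R := 2 `^ (p.+1%:R^-1).

Lemma grid_gt0 k : 0 < grid k.
Proof. exact: powR_gt0. Qed.

Lemma gridS k : grid k.+1 = grid_ratio * grid k.
Proof.
rewrite /grid /grid_ratio -powRD; last by rewrite pnatr_eq0 implybT.
have q0 : p.+1%:R != 0 :> R by rewrite pnatr_eq0.
congr (_ `^ _); rewrite -[k.+1%:R]natr1; move: (p.+1%:R) q0 => q q0; by field.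
Qed.

Lemma grid_octave k : grid (k + p.+1) = 2 * grid k.
Proof.
rewrite -[2 in RHS](@powRr1 R)// /grid -powRD; last by rewrite pnatr_eq0 implybT.
have q0 : p.+1%:R != 0 :> R by rewrite pnatr_eq0.
congr (_ `^ _); rewrite natrD; move: (p.+1%:R) q0 => q q0; by field.
Qed.

Lemma grid_ratio_gt1 : 1 < grid_ratio.
Proof.
rewrite /grid_ratio /powR pnatr_eq0 /= expR_gt1 mulr_gt0 ?invr_gt0//.
by rewrite ln_gt0 ?ltr1n.
Qed.

Lemma grid_weightE k : grid_weight k = (1 - grid_ratio^-1) / grid k.
Proof.
rewrite /grid_weight gridS invfM; ring.
Qed.

Lemma grid_weight_ge0 k : 0 <= grid_weight k.
Proof.
rewrite grid_weightE divr_ge0 ?(ltW (grid_gt0 k))//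
  subr_ge0 invf_le1 ?ltW ?grid_ratio_gt1//.
exact: lt_trans grid_ratio_gt1.
Qed.

Lemma grid_weight_octave k : grid_weight (k + p.+1) = grid_weight k / 2.
Proof. by rewrite !grid_weightE grid_octave invfM [2^-1 * _]mulrC mulrA. Qed.

(** This is 1 - e^-x <= x with x = ln 2 / (p + 1), and it is where the ln 2 of the theorem comes
    from: the dt/t mass of one octave. *)
Lemma octave_weight_le : p.+1%:R * (1 - grid_ratio^-1) <= ln 2.
Proof.
have q0 : 0 < p.+1%:R :> R by [].
have -> : grid_ratio^-1 = expR (- (ln 2 / p.+1%:R)).
  rewrite expRN /grid_ratio /powR pnatr_eq0 /=; congr (_^-1); congr expR; exact: mulrC.
rewrite mulrC -ler_pdivlMr// lerBlDr -lerBlDl.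
exact: expR_ge1Dx.
Qed.

(* (1 - e^-s)^2 = 2 (1 - e^-s) - (1 - e^-2s), so that on the grid each term is
   F k - F (k + p + 1) and the sum telescopes over octaves. *)
Lemma grid_sum_le (N : nat) (l : R) : 0 <= l ->
  \sum_(k < N) grid_weight k * (1 - expR (- grid k * l)) ^+ 2 <= 2 * ln 2 * l.
Proof.
move=> l0; pose F k := 2 * grid_weight k * (1 - expR (- grid k * l)).
have F0 k : 0 <= F k.
  rewrite /F !mulr_ge0 ?grid_weight_ge0// subr_ge0 -expR0 ler_expR mulNr oppr_le0.
  by rewrite mulr_ge0 ?(ltW (grid_gt0 k)).
have Fle k : F k <= 2 * (1 - grid_ratio^-1) * l.
  rewrite /F grid_weightE -!mulrA ler_pM2l// ler_wpM2l//.
    by rewrite subr_ge0 invf_le1 ?ltW ?grid_ratio_gt1// (lt_trans _ grid_ratio_gt1).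
  rewrite mulrC ler_pdivrMr ?grid_gt0// lerBlDr -lerBlDl.
  by apply: le_trans (expR_ge1Dx _); rewrite mulNr [l * _]mulrC.
have E k : grid_weight k * (1 - expR (- grid k * l)) ^+ 2 = F k - F (k + p.+1)%N.
  rewrite /F grid_weight_octave grid_octave.
  have -> : - (2 * grid k) * l = - grid k * l + - grid k * l by ring.
  by rewrite expRD; field.
under eq_bigr do rewrite E.
rewrite sumrB lerBlDr.
(* After telescoping, at most the first octave survives: p + 1 terms, each bounded by [Fle], with
   total at most 2 ln 2 l by [octave_weight_le]. *)
apply: (@le_trans _ _ (\sum_(k < p.+1) F k + \sum_(k < N) F (k + p.+1)%N)); last first.
  rewrite lerD2r; apply: (@le_trans _ _ (\sum_(k < p.+1) 2 * (1 - grid_ratio^-1) * l)).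
    exact: ler_sum.
  rewrite sumr_const card_ord -[_ *+ p.+1]mulr_natl mulrA ler_wpM2r//.
  by rewrite mulrCA ler_pM2l// octave_weight_le.
rewrite -(big_mkord xpredT F) -(big_mkord xpredT (fun k => F (k + p.+1)%N)).
rewrite -(big_mkord xpredT F).
have -> : \sum_(0 <= k < N) F (k + p.+1)%N = \sum_(p.+1 <= k < N + p.+1) F k.
  by rewrite -{2}[p.+1]add0n big_addn addnK.
rewrite -big_cat_nat ?leq_addl//= [leRHS](@big_cat_nat _ _ _ N) ?leq_addr//= lerDl.
by apply: sumr_ge0.
Qed.

(** The weights above a telescope from the first grid point beyond a, which overshoots a by at most
    the grid ratio unless it is already the first point of the grid. *)
Lemma grid_weight_tail (N : nat) (a : R) :
  (Num.max (grid_ratio * a) (grid 0))^-1 - (grid N)^-1 <=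
  \sum_(k < N) (if a < grid k then grid_weight k else 0).
Proof.
have m0 : 0 < Num.max (grid_ratio * a) (grid 0) by rewrite lt_max grid_gt0 orbT.
elim: N => [|N IH].
  by rewrite big_ord0 subr_le0 lef_pV2 ?posrE ?grid_gt0// le_max lexx orbT.
rewrite big_ord_recr /=; case: ifPn => [_|].
  by apply: le_trans (lerD IH (lexx (grid_weight N))); rewrite /grid_weight addrA subrK.
(* Here grid N <= a, so grid N.+1 is at most ratio * a and the left side is nonpositive. *)
rewrite -leNgt addr0 => ta; apply: (@le_trans _ _ 0); last first.
  by apply: sumr_ge0 => k _; case: ifP => // _; exact: grid_weight_ge0.
rewrite subr_le0 lef_pV2 ?posrE ?grid_gt0// le_max gridS ler_pM2l ?ta//.
exact: lt_trans grid_ratio_gt1.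
Qed.

End grid.

Section grid_limit.
Context {R : realType}.

Lemma grid_ratio_cvg : grid_ratio p @[p --> \oo] --> (1 : R).
Proof.
have -> : grid_ratio (R := R) = (fun p => expR (p.+1%:R^-1 * ln 2)).
  by apply/funext => p; rewrite /grid_ratio /powR pnatr_eq0.
have H : (p.+1%:R^-1 * ln (2 : R)) @[p --> \oo] --> 0 * ln (2 : R).
  by apply: cvgM; [exact: cvg_harmonic|exact: cvg_cst].
rewrite mul0r in H; rewrite -[X in _ --> X]expR0.
exact: (cvg_comp _ _ H (@continuous_expR R 0)).
Qed.

Lemma grid0 p : grid p 0 = 2 ^- p.+1 :> R.
Proof. by rewrite /grid mul0r sub0r powRN powR_mulrn. Qed.

(** 2 (p+1)^2 steps climb 2 (p+1) octaves, from 2^-(p+1) up to 2^(p+1); both ends leave every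
    compact subset of ]0, +oo[ as p grows. *)
Lemma grid_last p : (grid p (2 * (p.+1 * p.+1)))^-1 = 2 ^- p.+1 :> R.
Proof.
have q0 : p.+1%:R != 0 :> R by rewrite pnatr_eq0.
rewrite /grid !natrM (_ : _ - _ = p.+1%:R); first by rewrite powR_mulrn.
by move: (p.+1%:R) q0 => q q0; field.
Qed.

End grid_limit.

(** * The main estimate *)

Section main_estimate.
Context {R : realType} {d : measure_display} {X : measurableType d}.
Variable mu : {measure set X -> \bar R}.
Variables (A : graph R X) (E : set R -> (X -> R[i]) -> X -> R[i]).
Hypothesis A_selfadjoint : selfadjoint mu A.
Hypothesis A_positive : positive_operator mu A.
Hypothesis A_resolution : spectral_resolution mu A E.
Hypothesis M_finite : forall t : R, 0 < t -> (M_fun mu A t < +oo)%E.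
Variables (f sf : X -> R[i]).
Hypothesis f_V : V_space mu A f.
Hypothesis f_sqrt : spectral_integral mu E Num.sqrt f sf.
Local Notation ip := (real_inner mu).
Local Notation pvmq := (pvm_form mu E).
Local Notation nu := (spectral_measure mu E).
Local Notation Q := (spectral_int mu E).
Local Notation form := (polar_form mu E).
Implicit Types (g h u v : X -> R[i]) (B C : set R) (phi psi : R -> R).

Let P : projection_valued_measure mu E := A_resolution.1.

Let Hf : inL2 mu f. Proof. by case: f_V. Qed.

Let Dsqrt : spectral_dom mu E Num.sqrt f. Proof. by case: f_sqrt. Qed.

Let Isqrt := spectral_dom_sqr_integrable P (@measurable_sqrt R) Dsqrt.

Let En : R := ip sf sf.

(** The zero vector is an admissible input, so the supremum is not the -oo of an empty family. *)
Lemma L_fun_ge0 s : 0 <= s -> (0 <= L_fun mu A s)%E.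
Proof.
move=> s0; have H0 := inL2_0 mu.
have c0 : cLnorm mu 1%:E (fun=> 0) = 0%E.
  rewrite /cLnorm -[RHS](Lnorm0 mu (p := 1%E))//; congr Lnorm.
  by apply/funext => x /=; rewrite expr0n /= addr0 sqrtr0.
have := @Q_heatf_le_L _ _ _ mu A E A_selfadjoint A_positive A_resolution s (fun=> 0) s0 H0.
rewrite /inLp c0 => H; apply: le_trans (H _ _); rewrite ?lee01//.
  by rewrite lee_fin; apply: Rintegral_ge0 => l _; have /andP[] := heatf01 l s0.
Qed.

Lemma M_fun_antitone a b : 0 <= a -> a <= b -> (M_fun mu A b <= M_fun mu A a)%E.
Proof.
move=> a0 ab; rewrite /M_fun [leLHS]integral_mkcond [leRHS]integral_mkcond.
have L0 (s : R) : 0 <= a -> a < s -> (0 <= L_fun mu A s)%E.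
  by move=> ? /ltW h; apply: L_fun_ge0; exact: le_trans h.
apply: ge0_le_integral_nonmeasurable => s _; rewrite !patchE !mem_setE !in_itv /= !andbT.
  by case: ifPn => // /(le_lt_trans ab)/(L0 _ a0).
case: ifPn => [/(le_lt_trans ab) as_|_]; first by rewrite as_.
by case: ifPn => // /(L0 _ a0).
Qed.

Lemma M_inv_lt y t : (M_inv mu A y < t%:E)%E -> (M_fun mu A t <= y%:E)%E.
Proof.
move=> /ereal_inf_lt[_ [s [s0 My] <-]]; rewrite lte_fin => /ltW st.
exact: le_trans (M_fun_antitone (ltW s0) st) My.
Qed.

Lemma M_inv_ge0 y : (0 <= M_inv mu A y)%E.
Proof. by apply: le_ereal_inf_tmp => _ [s [s0 _] <-]; rewrite lee_fin ltW. Qed.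

(** The multiplier whose spectral integral is |f - T_t f|^2 for f in V. *)
Definition heat_defect (t l : R) : R := if 0 < l then (1 - expR (- t * l)) ^+ 2 else 0.

Lemma heat_defectE t l : heat_defect t l =
  \1_(`]0, +oo[%classic : set R) l - 2 * heat_mult t l + heat_mult t l ^+ 2.
Proof.
rewrite /heat_defect indicE mem_pos heatfE; case: ifP => _ /=; ring.
Qed.

Lemma heat_defect_integrable t : 0 <= t -> (nu f).-integrable setT (EFin \o heat_defect t).
Proof.
move=> t0; apply: (nu_bounded_integrable mu E f measurableT (M := 1)).
  rewrite (_ : heat_defect t = (fun l => \1_(`]0, +oo[%classic : set R) l - 2 *
    heat_mult t l + heat_mult t l ^+ 2)).
    apply: measurable_funD; last by apply: measurable_funX; exact: measurable_heatf.
    apply: measurable_funB; first by apply: measurable_indic; exact: measurable_itv.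
    by apply: measurable_funM => //; exact: measurable_heatf.
  by apply/funext => l; rewrite heat_defectE.
move=> l _; rewrite /heat_defect; case: ifPn => [l0|_]; last by rewrite normr0.
have := heatf01 l t0; rewrite heatfE l0 => /andP[h1 h2].
rewrite ger0_norm ?sqr_ge0// expr_le1// ?subr_ge0//; lra.
Qed.

Lemma heat_smoothing t : 0 < t -> exists g, [/\ inL2 mu g,
  {ae mu, forall x, sqc (g x) <= En * fine (M_fun mu A (2 * t))} &
  ip (fun x => f x - g x) (fun x => f x - g x) <= Q (heat_defect t) f].
Proof.
move=> t0; have [g [Hg _ ipg ipgg]] := heat_exists A_resolution (ltW t0) Hf.
exists g; split => //.
- have t20 : 0 < 2 * t by rewrite mulr_gt0.
  set m := fine _; have Mm : M_fun mu A (2 * t) = m%:E.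
    rewrite /m fineK// ge0_fin_numE ?M_finite//.
    apply: integral_ge0 => s; rewrite /= in_itv /= andbT => /ltW h.
    by apply: L_fun_ge0; apply: le_trans h; rewrite ltW.
  have m0 : 0 <= m.
    rewrite -lee_fin -Mm; apply: integral_ge0 => s; rewrite /= in_itv /= andbT => /ltW h.
    by apply: L_fun_ge0; apply: le_trans h; rewrite ltW.
  have En0 : 0 <= En by exact: ip_ge0.
  have H u : inL2 mu u -> inLp mu 1%:E u -> (cLnorm mu 1%:E u <= 1)%E -> ip g u <=
    Num.sqrt (En * m).
    move=> Hu Hu1 u1; have le_M := integral_resf_le_M A_selfadjoint A_positive
      A_resolution t0 Hu Hu1 u1.
    have Ires : (nu u).-integrable setT (EFin \o (fun l => sqrt_res_mult t l ^+ 2)).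
      apply/integrableP; split.
        by apply/measurable_EFinP; apply: measurable_funX; exact: measurable_resf.
      under eq_integral do rewrite /= ger0_norm ?sqr_ge0//.
      by apply: le_lt_trans le_M _; rewrite Mm ltry.
    have Qres : Q (fun l => sqrt_res_mult t l ^+ 2) u <= m.
      rewrite -lee_fin -Mm /spectral_int /Rintegral fineK//.
      exact: (integrable_fin_num measurableT Ires).
    apply: le_trans (ler_norm _) _; rewrite -sqrtr_sqr ler_wsqrtr//.
    (* Splitting e^{-tl} as l^{1/2} times l^{-1/2} e^{-tl} separates the energy of f from the heat
       kernel tested on u. *)
    rewrite ipg// (_ : heat_mult t = (fun l => Num.sqrt l * sqrt_res_mult t l)); last first.
      by apply/funext => l; rewrite sqrt_resf.
    have := form_cauchy_schwarz P (@measurable_sqrt R) (measurable_resf t)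
      (@sqrtr_ge0 R) (resf_ge0 t) _ Hf Hu Isqrt Ires.
    move=> /(_ _)/le_trans; apply.
      by move=> l; rewrite sqrt_resf; have /andP[] := heatf01 l (ltW t0).
    apply: ler_pM; last exact: Qres.
    - by apply: Rintegral_ge0 => l _; exact: sqr_ge0.
    - by apply: Rintegral_ge0 => l _; exact: sqr_ge0.
    - exact: (Q_sqr_le_ip P (@measurable_sqrt R) (@sqrtr_ge0 R) f_sqrt).
  have := ae_normc_le Hg (sqrtr_ge0 _) H.
  apply: filterS => x gx; rewrite -normc_sqc.
  rewrite -[leRHS](sqr_sqrtr (mulr_ge0 En0 m0)).
  by rewrite lerXn2r// nnegrE ?normc_ge0 ?sqrtr_ge0.
- have mp := measurable_itv `]0, +oo[ : measurable (`]0, +oo[%classic : set R).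
  have If t' : 0 <= t' -> (nu f).-integrable setT (EFin \o heat_mult t') by exact:
    heatf_integrable.
  have I0 : (nu f).-integrable setT (EFin \o \1_(`]0, +oo[%classic : set R)).
    apply: (nu_bounded_integrable mu E f measurableT (M := 1)) => // l _.
    by rewrite indicE; case: (_ \in _); rewrite ?normr1 ?normr0.
  have I1 := heatf_integrable mu E f (ltW t0).
  have I2 : (nu f).-integrable setT (EFin \o (fun l => heat_mult t l ^+ 2)).
    apply: (nu_bounded_integrable mu E f measurableT (M := 1)).
      by apply: measurable_funX; exact: measurable_heatf.
    move=> l _; have /andP[h1 h2] := heatf01 l (ltW t0).
    by rewrite ger0_norm ?sqr_ge0// expr_le1.
  (* As f is in V, |f|^2 is its spectral mass on ]0, +oo[. What is known of |g|^2 is an upper bound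
     by the last term, which is the direction wanted. *)
  have -> : Q (heat_defect t) f = ip f f - 2 * ip g f + Q (fun l => heat_mult t l ^+ 2) f.
    have I1' := integrableZl measurableT 2 I1.
    rewrite (V_space_proj A_selfadjoint A_positive A_resolution f_V Hf) -(Q_indic P mp Hf).
    rewrite ipg// (form_diag P (measurable_heatf t) _ Hf); last by move=> l;
      have /andP[] := heatf01 l (ltW t0).
    rewrite /spectral_int -(RintegralZl _ measurableT I1) -(RintegralB measurableT I0 I1').
    rewrite -RintegralD//; last exact: (integrableB measurableT I0 I1').
    by apply: eq_Rintegral => l _; rewrite heat_defectE.
  rewrite ipBl// ?ipBr//; last exact: inL2B.
  rewrite [ip f g]ipC.
  by move: ipgg; set a := ip f f; set b := ip g f; set c := ip g g; lra.
Qed.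

Lemma integral_sqc h : inL2 mu h -> (\int[mu]_x (sqc (h x))%:E = (ip h h)%:E)%E.
Proof.
move=> Hh; rewrite ipE /Rintegral fineK;
  last exact: (integrable_fin_num measurableT (ip_integrable Hh Hh)).
by apply: eq_integral => x _; rewrite /sqc !expr2.
Qed.

Lemma Q_sum (a : nat -> R -> R) (w : nat -> R) N h :
  (forall k, (nu h).-integrable setT (EFin \o a k)) ->
  (nu h).-integrable setT (EFin \o (fun l => \sum_(k < N) w k * a k l)) /\
  Q (fun l => \sum_(k < N) w k * a k l) h = \sum_(k < N) w k * Q (a k) h.
Proof.
move=> Ia; elim: N => [|N [I IH]].
  rewrite big_ord0; split.
    by apply: (eq_integrable measurableT (cst 0%E)); [move=> l _ /=;
      rewrite big_ord0|exact: integrable0].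
  by rewrite /spectral_int /Rintegral integral0_eq// => l _; rewrite big_ord0.
have IN := integrableZl measurableT (w N) (Ia N).
split.
  have := integrableD measurableT I IN; apply: eq_integrable => // l _.
  by rewrite /= big_ord_recr.
rewrite big_ord_recr /= -IH /spectral_int -(RintegralZl _ measurableT (Ia N)) -RintegralD//.
by apply: eq_Rintegral => l _; rewrite big_ord_recr.
Qed.

(** [grid_sum_le] integrated against the spectral measure of f; for l <= 0 the defects vanish. *)
Lemma sum_heat_defect_le p N :
  \sum_(k < N) grid_weight p k * Q (heat_defect (grid p k)) f <= 2 * ln 2 * En.
Proof.
have Id k := heat_defect_integrable (ltW (grid_gt0 p k)).
have [I <-] := Q_sum (grid_weight p) N Id.
apply: (@le_trans _ _ (2 * ln 2 * Q (fun l => Num.sqrt l ^+ 2) f)); last first.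
  rewrite ler_wpM2l ?mulr_ge0 ?ln_ge0 ?ler1n//.
  exact: (Q_sqr_le_ip P (@measurable_sqrt R) (@sqrtr_ge0 R) f_sqrt).
rewrite [leRHS](_ : _ = Q (fun l => 2 * ln 2 * Num.sqrt l ^+ 2) f); last first.
  by rewrite /spectral_int (RintegralZl _ measurableT Isqrt).
apply: le_Q => //; first exact: (integrableZl measurableT (2 * ln 2) Isqrt).
move=> l; rewrite /heat_defect; case: (ltP 0 l) => l0.
  by rewrite (sqr_sqrtr (ltW l0)); apply: grid_sum_le; exact: ltW.
by rewrite big1 ?mulr_ge0 ?sqr_ge0 ?ln_ge0 ?ler1n// => k _; rewrite mulr0.
Qed.

(** If |w| <= |z| / 2 then |z - w| >= |z| / 2; in squared form it follows from |z - 2w|^2 >= 0. *)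
Lemma sqc_split (z w : R[i]) : sqc w <= sqc z / 4 -> sqc z / 4 <= sqc (z - w).
Proof.
move=> h; have : 0 <= sqc (z - 2%:R * w) by exact: sqc_ge0.
move: h; rewrite /sqc !reimE /=; case: z => a b; case: w => c e /=.
nra.
Qed.

(* At a grid point t > M_inv y / 2 one has M(2t) <= y, i.e. |e^-tA f|^2 <= |f|^2 / 4. *)
Lemma defect_lower_bound p N y (a : R) (z : R[i]) (G : nat -> R[i]) :
  sqc z = 4 * En * y -> 0 <= y -> (M_inv mu A y <= (2 * a)%:E)%E ->
  (forall k, sqc (G k) <= En * fine (M_fun mu A (2 * grid p k))) ->
  2 * En * (y / 2 * ((Num.max (grid_ratio p * a) (grid p 0))^-1 - (grid p N)^-1)) <=
  \sum_(k < N) grid_weight p k * sqc (z - G k).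
Proof.
move=> zE y0 ya GM; have En0 : 0 <= En by exact: ip_ge0.
(* Each grid point beyond a contributes at least its weight times |z|^2 / 4 = En y; the others are
   bounded below by 0. *)
apply: (@le_trans _ _ (\sum_(k < N) (if a < grid p k then grid_weight p k else 0) * (En
  * y))).
  have -> r : 2 * En * (y / 2 * r) = r * (En * y) by field.
  by rewrite -mulr_suml ler_wpM2r ?mulr_ge0// grid_weight_tail.
apply: ler_sum => k _; case: ifPn => [ak|_]; last first.
  by rewrite mul0r mulr_ge0 ?grid_weight_ge0 ?sqc_ge0.
rewrite ler_wpM2l ?grid_weight_ge0//.
have -> : En * y = sqc z / 4 by rewrite zE; field.
apply: sqc_split; apply: le_trans (GM k) _.
have -> : sqc z / 4 = En * y by rewrite zE; field.
rewrite ler_wpM2l//.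
have tk0 : 0 < 2 * grid p k :> R by apply: mulr_gt0 => //; exact: grid_gt0.
have My : (M_fun mu A (2 * grid p k) <= y%:E)%E.
  by apply: M_inv_lt; apply: le_lt_trans ya _; rewrite lte_fin ltr_pM2l.
rewrite -lee_fin fineK//; rewrite ge0_fin_numE ?M_finite//.
apply: integral_ge0 => s; rewrite /= in_itv /= andbT => /ltW h.
by apply: L_fun_ge0; apply: le_trans h; rewrite ltW.
Qed.

End main_estimate.

Lemma le_limn_einf (R : realType) (u v : (\bar R)^nat) :
  (forall n, (u n <= v n)%E) -> (limn_einf u <= limn_einf v)%E.
Proof.
move=> uv; rewrite !limn_einf_lim; apply: lee_lim;
  [exact: is_cvg_einfs|exact: is_cvg_einfs|].
apply: nearW => n; apply: le_ereal_inf_tmp => _ [k nk <-].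
by apply: le_trans (uv k); apply: ereal_inf_lbound; exists k.
Qed.

(** * Refining the grid *)

Section limit.
Context {R : realType}.

(** What the p-th grid certifies towards y / M_inv y when M_inv y <= 2a: y / 2 times the dt/t^2 mass
    it is sure to see beyond a. *)
Definition grid_bound p (a y : R) : R :=
  y / 2 * ((Num.max (grid_ratio p * a) (grid p 0))^-1 - 2 ^- p.+1).

Lemma exp2N_cvg0 : (2 ^- p.+1 : R) @[p --> \oo] --> (0 : R).
Proof.
under eq_fun do rewrite -exprVn.
have : ((2^-1 : R) ^+ n) @[n --> \oo] --> (0 : R).
  by apply: cvg_expr; rewrite gtr0_norm ?invr_gt0// invf_lt1// ltr1n.
by rewrite -(cvg_shiftS (fun n => (2^-1 : R) ^+ n)).
Qed.

Lemma grid_bound_cvg a y : 0 < a -> grid_bound p a y @[p --> \oo] --> y / (2 * a).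
Proof.
move=> a0; have H : y / 2 * ((grid_ratio p * a)^-1 - 2 ^- p.+1) @[p --> \oo] --> y / (2
  * a).
  rewrite (_ : y / (2 * a) = y / 2 * ((1 * a)^-1 - 0));
    last by rewrite mul1r subr0 invfM mulrA.
  apply: cvgM; first exact: cvg_cst.
  apply: cvgB; last exact: exp2N_cvg0.
  apply: cvgV; first by rewrite mul1r gt_eqF.
  by apply: cvgM; [exact: grid_ratio_cvg|exact: cvg_cst].
apply: cvg_trans H; apply: near_eq_cvg; near=> p.
rewrite /grid_bound grid0 max_l//; apply: (@le_trans _ _ a).
  by apply: ltW; near: p; exact: (cvgr_lt _ exp2N_cvg0).
by rewrite ler_peMl ?ltW// grid_ratio_gt1.
Unshelve. all: by end_near. Qed.

(** With a = 0 only the first grid point 2^-(p+1) limits the mass, which grows like 2^p. This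
    matches the value +oo of N where M_inv y = 0. *)
Lemma grid_bound0_cvg y : 0 < y -> grid_bound p 0 y @[p --> \oo] --> +oo.
Proof.
move=> y0; apply/cvgryPge => M.
near=> p.
rewrite /grid_bound mulr0 max_r ?grid0 ?invr_ge0 ?exprn_ge0// invrK.
apply: (@le_trans _ _ (y / 2 * (p%:R))).
  rewrite mulrC -ler_pdivrMr ?divr_gt0//; near: p; exact: nbhs_infty_ger.
rewrite ler_pM2l ?divr_gt0// lerBrDr.
apply: (@le_trans _ _ (p.+1%:R)).
  by rewrite -[p.+1%:R]natr1 lerD2l invf_le1 ?exprn_gt0// exprn_ege1// ler1n.
by rewrite -natrX ler_nat; apply: ltnW; exact: ltn_expl.
Unshelve. all: by end_near. Qed.

End limit.

Section N_bound.
Context {R : realType} {d : measure_display} {X : measurableType d}.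
Variables (mu : {measure set X -> \bar R}) (A : graph R X).

Lemma N_fun_le_limn_einf (y : R) (c : nat -> \bar R) : 0 <= y ->
  (0 <= M_inv mu A y)%E -> (forall p, (0 <= c p)%E) ->
  (forall p a, 0 <= a -> (M_inv mu A y <= (2 * a)%:E)%E -> ((grid_bound p a y)%:E <= c
    p)%E) ->
  (N_fun mu A y <= limn_einf c)%E.
Proof.
move=> y0 Mi0 c0 H.
have lim0 : (0 <= limn_einf c)%E.
  have := le_limn_einf c0; rewrite (cvg_limn_einf_sup (cvg_cst _)).1//.
rewrite /N_fun; move: Mi0 H; case: (M_inv mu A y) => [r||]//= r0 H; last first.
  by rewrite invey mule0.
move: y0; rewrite le_eqVlt => /predU1P[<-|y0]; first by rewrite mul0e.
rewrite lee_fin in r0.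
(* The threshold is half of M_inv y because M is evaluated at twice the grid point. *)
have a0 : 0 <= r / 2 by rewrite divr_ge0.
have {}H p : ((grid_bound p (r / 2) y)%:E <= c p)%E.
  by apply: H => //; rewrite mulrC divfK.
apply: le_trans (le_limn_einf H).
move: r0; rewrite le_eqVlt => /predU1P[r0|r0].
  have := grid_bound0_cvg y0.
  rewrite -{1}[0](mul0r (2^-1)) {1}r0 => /cvgeryP h.
  by rewrite (cvg_limn_einf_sup h).1 leey.
have := @grid_bound_cvg R (r / 2) y; rewrite divr_gt0//
  (_ : 2 * (r / 2) = r) => [/(_ isT) h|]; last by field.
have {}h : (grid_bound p (r / 2) y)%:E @[p --> \oo] --> (y / r)%:E by apply/cvg_EFin =>
  //; exact: nearW.
by rewrite (cvg_limn_einf_sup h).1 inver gt_eqF// -EFinM.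
Qed.

End N_bound.

Theorem theorem1p2 (R : realType) (d : measure_display) (X : measurableType d)
    (mu : {measure set X -> \bar R}) (A : graph R X)
    (A_selfadjoint : selfadjoint mu A) (A_positive : positive_operator mu A)
    (L_finite : forall t : R, 0 < t -> (L_fun mu A t < +oo)%E)
    (M_finite : forall t : R, 0 < t -> (M_fun mu A t < +oo)%E)
    (f sqrtA_f : X -> R[i])
    (f_V : V_space mu A f)
    (f_neq0 : ~ (f = (fun=> 0) %[ae mu]))
    (f_energy : sqrt_operator mu A f sqrtA_f) :
  let energy : R := norm2 mu sqrtA_f ^+ 2 in
  (\int[mu]_x N_fun mu A (Normc.normc (f x) ^+ 2 / (4 * energy))
     <= (ln 2)%:E)%E.
Proof.
cbv zeta; set energy : R := norm2 mu sqrtA_f ^+ 2.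
have [E AE f_sqrt] := f_energy.
have [Hf _] := f_V.
have Hsf : inL2 mu sqrtA_f by case: f_sqrt.
have ln2 : 0 <= ln 2 :> R by rewrite ln_ge0// ler1n.
have energyE : energy = real_inner mu sqrtA_f sqrtA_f by rewrite /energy norm2_ip.
have : 0 <= energy by rewrite energyE; exact: ip_ge0.
rewrite le_eqVlt => /predU1P[en0|en0].
  (* With zero energy the convention x / 0 = 0 makes the integrand N(0) = 0. *)
  rewrite integral0_eq ?lee_fin// => x _.
  by rewrite -en0 mulr0 invr0 mulr0 /N_fun mul0e.
(* One representative of T_t f is fixed for each t > 0; f is a dummy value for the other t. *)
have /choice[G HG] (t : R) : exists g, 0 < t -> [/\ inL2 mu g,
    {ae mu, forall x, sqc (g x) <= energy * fine (M_fun mu A (2 * t))} &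
    real_inner mu (fun x => f x - g x) (fun x => f x - g x) <= spectral_int mu E
      (heat_defect t) f].
  have [t0|_] := ltP 0 t; last by exists f.
  have [g Hg] := heat_smoothing A_selfadjoint A_positive AE M_finite f_V f_sqrt t0.
  by exists g => _; rewrite energyE.
pose N p := (2 * (p.+1 * p.+1))%N.
pose g p k := G (grid p k).
have Hg p k : inL2 mu (g p k) by have [] := HG _ (grid_gt0 p k).
have Hfg p k : inL2 mu (fun x => f x - g p k x) by exact: inL2B.
(* Grid version of the integral of |f - T_t f|^2 dt/t^2, normalized by 2 E(f) so that the spectral
   bound becomes ln 2. *)
pose C p x : R := (2 * energy)^-1 * \sum_(k < N p) grid_weight p k * sqc (f x - g p k x).
have e20 : 0 < 2 * energy by rewrite mulr_gt0.
have C0 p x : 0 <= C p x.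
  rewrite mulr_ge0 ?invr_ge0 ?(ltW e20)//; apply: sumr_ge0 => k _.
  by rewrite mulr_ge0 ?grid_weight_ge0 ?sqc_ge0.
have mC p : measurable_fun setT (fun x => (C p x)%:E).
  apply/measurable_EFinP; apply: measurable_funM => //; apply: measurable_sum => k.
  apply: measurable_funM => //.
  by have /inL2P[_ /integrableP[/measurable_EFinP]] := Hfg p k.
have IC p : (\int[mu]_x (C p x)%:E <= (ln 2)%:E)%E.
  have IS k := integrableZl measurableT (grid_weight p k) (iffLR (inL2P mu _) (Hfg p k)).2.
  have -> : (\int[mu]_x (C p x)%:E = ((2 * energy)^-1 *
      \sum_(k < N p) grid_weight p k * real_inner mu (fun x => f x - g p k x) (fun x =>
        f x - g p k x))%R%:E)%E.
    under eq_integral do rewrite /C EFinM -sumEFin.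
    rewrite integralZl//; last by apply: integrable_sum => // k _; exact: IS.
    rewrite integral_sum//; last by move=> k; exact: IS.
    rewrite EFinM -sumEFin; congr (_ * _)%E; apply: eq_bigr => k _.
    rewrite EFinM -integral_sqc// -integralZl//.
    by have /inL2P[] := Hfg p k.
  rewrite lee_fin mulrC ler_pdivrMr//.
  have := sum_heat_defect_le AE f_sqrt p (N p); rewrite -energyE => h.
  apply: le_trans (le_trans _ h) _; last by rewrite le_eqVlt; apply/orP; left;
    apply/eqP; ring.
  apply: ler_sum => k _; rewrite ler_wpM2l ?grid_weight_ge0//.
  by have [] := HG _ (grid_gt0 p k).
(* A single null set for all grids and all grid points, as there are countably many. *)
have [Z [mZ Z0 Zsub]] : {ae mu, forall x p k, sqc (g p k x) <= energy * fine (M_fun mu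
  A (2 * grid p k))}.
  apply: ae_foralln => p; apply: ae_foralln => k.
  by have [] := HG _ (grid_gt0 p k).
(* Infinite on the exceptional set: N_fun may fail to be measurable, so the bound
   below is needed everywhere, not only a.e. *)
pose D p x : \bar R := ((C p x)%:E + (cst +oo%E \_ Z) x)%E.
have Zoo0 x : (0 <= (cst +oo%E \_ Z) x :> \bar R)%E by rewrite patchE;
  case: ifP => _ /=; rewrite ?leey.
have D0 p x : (0 <= D p x)%E by rewrite adde_ge0// lee_fin.
have mZoo : measurable_fun setT (cst +oo%E \_ Z : X -> \bar R).
  by apply: (iffLR (measurable_restrictT _ mZ)); exact: measurable_cst.
have mD p : measurable_fun setT (D p) by exact: emeasurable_funD.
have ID p : (\int[mu]_x D p x <= (ln 2)%:E)%E.
  rewrite ge0_integralD//; last by move=> x _; rewrite lee_fin.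
  by rewrite -integral_mkcond integral_cst// Z0 mule0 adde0.
(* The integrand lies below this lower limit at every point, and Fatou bounds the integral of the
   lower limit by ln 2. *)
apply: (@le_trans _ _ (\int[mu]_x limn_einf (D ^~ x))%E).
  apply: ge0_le_integral_nonmeasurable => x _.
    rewrite /N_fun mule_ge0 ?lee_fin ?inve_ge0 ?(M_inv_ge0 _ A)//.
    by rewrite divr_ge0 ?sqr_ge0// mulr_ge0// ltW.
  have y0 : 0 <= Normc.normc (f x) ^+ 2 / (4 * energy).
    by rewrite divr_ge0 ?sqr_ge0// mulr_ge0// ltW.
  apply: N_fun_le_limn_einf => //; first exact: M_inv_ge0.
  move=> p a a0 Ma; rewrite /D patchE; case: ifPn => [_|xZ].
    by rewrite addey// leey.
  rewrite adde0 lee_fin.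
  have good k : sqc (g p k x) <= energy * fine (M_fun mu A (2 * grid p k)).
    apply: contrapT => bad; move: xZ; rewrite notin_setE; apply; apply: Zsub => /= h.
    exact: bad.
  rewrite /C [leRHS]mulrC ler_pdivlMr// [leLHS]mulrC.
  rewrite /grid_bound -grid_last.
  have := @defect_lower_bound _ _ _ mu A E A_selfadjoint A_positive AE M_finite sqrtA_f
    p (N p) _ a (f x) (fun k => g p k x) _ y0 Ma.
  rewrite -energyE; apply => //.
  by rewrite -normc_sqc; field; rewrite gt_eqF.
apply: le_trans (fatou mu measurableT mD (fun p x _ => D0 p x)) _.
have := le_limn_einf ID; rewrite (cvg_limn_einf_sup (cvg_cst _)).1.
exact.
Qed.
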